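(* Let $d\ge2$ and let $Y_1,\ldots,Y_n$ be (possibly dependent) random vectors in $\mathbb{R}^d$ that are almost surely in type $B$ general position. Then, for all $k=1,\ldots,d$, the expected number of $k$-faces of the Weyl random cone $\mathcal{D}_n^B$ of type $B_n$ is $$\mathbb{E} f_k(\mathcal{D}_n^B)=\frac{2^{d-k}\binom{n}{d-k}D^B(n-d+k,k)}{D^B(n,d)}\cdot\frac{n!}{(n-d+k)!}.$$
   Context: Type $B$ general position: vectors $y_1,\ldots,y_n\in\mathbb{R}^d$ are said to be in type $B$ general position if $n\ge d$ and, for every $\varepsilon=(\varepsilon_1,\ldots,\varepsilon_n)\in\{\pm1\}^n$ and every permutation $\sigma$ of $\{1,\ldots,n\}$, any $d$ of the vectors $\varepsilon_1y_{\sigma(1)}-\varepsilon_2y_{\sigma(2)},\ldots,\varepsilon_{n-1}y_{\sigma(n-1)}-\varepsilon_ny_{\sigma(n)},\,\varepsilon_ny_{\sigma(n)}$ are linearly independent. For $x\in\mathbb{R}^d\setminus\{0\}$ let $x^\perp=\{v\in\mathbb{R}^d:\langle v,x\rangle=0\}$. The Weyl tessellation $\mathcal{W}^B(y_1,\ldots,y_n)$ of type $B_n$ is the set of cones obtained as closures of the connected components of the complement in $\mathbb{R}^d$ of the union of the hyperplanes $(y_i+y_j)^\perp$ and $(y_i-y_j)^\perp$ for $1\le i<j\le n$, and $y_i^\perp$ for $1\le i\le n$. The Weyl random cone $\mathcal{D}_n^B$ is obtained by choosing uniformly at random one of the cones of the random tessellation $\mathcal{W}^B(Y_1,\ldots,Y_n)$;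 that is, for a functional $\varphi$ of cones, $\mathbb{E}\varphi(\mathcal{D}_n^B)=\mathbb{E}\big[\frac{1}{\#\mathcal{W}^B(Y_1,\ldots,Y_n)}\sum_{C\in\mathcal{W}^B(Y_1,\ldots,Y_n)}\varphi(C)\big]$. For a polyhedral cone $C$, $f_k(C)$ is the number of its $k$-dimensional faces, where faces are obtained by replacing some (possibly none) of the half-spaces defining $C$ by their boundaries. The numbers $B[n,k]$ are defined by $(t+1)(t+3)\cdots(t+2n-1)=\sum_{k=0}^nB[n,k]\,t^k$, with $B[n,k]=0$ for $k\notin\{0,\ldots,n\}$, and $D^B(m,k):=2\sum_{i\ge 0}B[m,m-k+1+2i]$. *)

(* Defs.v *)
From HB Require Import structures.
From mathcomp Require Import all_boot all_order all_fingroup all_algebra.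
From mathcomp Require Import finmap.
From mathcomp Require Import all_classical all_reals all_analysis.

Set Implicit Arguments.
Unset Strict Implicit.
Unset Printing Implicit Defensive.

Import Order.TTheory GRing.Theory Num.Theory.
Import numFieldNormedType.Exports.
Local Open Scope classical_set_scope.
Local Open Scope ring_scope.

(* Vectors of R^d are row vectors 'rV[R]_d,
   with the topology that the library puts on matrices (the usual one). *)

Definition dotr (R : realType) (d : nat) (u v : 'rV[R]_d) : R :=
  \sum_(j < d) u 0 j * v 0 j.

Definition hyperplane (R : realType) (d : nat) (x : 'rV[R]_d) :
    set 'rV[R]_d :=
  [set v | dotr v x = 0].

(* The i-th of the n vectors e_1 y_s(1) - e_2 y_s(2), ...,
   e_(n-1) y_s(n-1) - e_n y_s(n), e_n y_s(n): there is no successor to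
   subtract when [insub i.+1 : option 'I_n] is [None], i.e. for the last
   index. The sign e_i is (-1)^(e i) for a boolean e i. *)
Definition chain_vec (R : realType) (d n : nat) (y : 'I_n -> 'rV[R]_d)
    (e : {ffun 'I_n -> bool}) (s : {perm 'I_n}) (i : 'I_n) : 'rV[R]_d :=
  let x (j : 'I_n) := (-1) ^+ e j *: y (s j) in
  x i - oapp x 0 (insub i.+1).

(* [free] is linear independence of a sequence, counted with repetitions. *)
Definition typeB_general_position (R : realType) (d n : nat)
    (y : 'I_n -> 'rV[R]_d) : Prop :=
  (d <= n)%N /\
  forall (e : {ffun 'I_n -> bool}) (s : {perm 'I_n}) (J : {set 'I_n}),
    #|J| = d -> free [seq chain_vec y e s i | i <- enum J].

Definition arrangementB (R : realType) (d n : nat) (y : 'I_n -> 'rV[R]_d) :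
    set 'rV[R]_d :=
  [set v | (exists i j : 'I_n, (i < j)%N /\
              (hyperplane (y i + y j) v \/ hyperplane (y i - y j) v))
           \/ (exists i : 'I_n, hyperplane (y i) v)].

Definition weylB (R : realType) (d n : nat) (y : 'I_n -> 'rV[R]_d) :
    set (set 'rV[R]_d) :=
  [set closure (connected_component (~` arrangementB y) v)
     | v in ~` arrangementB y].

(* F arises from some presentation of C as a finite intersection of closed
   half-spaces by turning the half-spaces indexed by J into their boundary
   hyperplanes. Which sets arise does not depend on the presentation: they are
   the intersections of C with its supporting hyperplanes, and C itself. *)
Definition is_face (R : realType) (d : nat) (C F : set 'rV[R]_d) : Prop :=
  exists (m : nat) (a : 'I_m -> 'rV[R]_d) (J : {set 'I_m}),
    [/\ forall i, a i != 0,
        C = [set v | forall i, dotr v (a i) <= 0]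
      & F = [set v | (forall i, dotr v (a i) <= 0) /\
                     (forall i, i \in J -> dotr v (a i) = 0)]].

Definition is_linear_hull (R : realType) (d : nat) (A : set 'rV[R]_d)
    (U : {vspace 'rV[R]_d}) : Prop :=
  A `<=` [set` U] /\
  forall W : {vspace 'rV[R]_d}, A `<=` [set` W] -> (U <= W)%VS.

(* For sets containing 0, such as cones and their faces, the linear hull is
   also the affine hull. *)
Definition has_dim (R : realType) (d : nat) (A : set 'rV[R]_d) (k : nat) :
    Prop :=
  exists2 U : {vspace 'rV[R]_d}, is_linear_hull A U & \dim U = k.

Definition nfaces (R : realType) (d k : nat) (C : set 'rV[R]_d) : nat :=
  #|` fset_set [set F : set 'rV[R]_d | is_face C F /\ has_dim F k]|.

Definition random_vector (R : realType) (disp : measure_display)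
    (T : measurableType disp) (d : nat) (Y : T -> 'rV[R]_d) : Prop :=
  forall j : 'I_d, measurable_fun [set: T] (fun w => Y w 0 j).

(* The mean of phi over the cones of W^B(y); weylB y is always finite. *)
Definition weylB_mean (R : realType) (d n : nat) (y : 'I_n -> 'rV[R]_d)
    (phi : set 'rV[R]_d -> R) : R :=
  (#|` fset_set (weylB y)|%:R)^-1 * \sum_(C \in weylB y) phi C.

(* E phi(D_n^B) for the Weyl random cone D_n^B of Y_1, ..., Y_n, which given
   the Y_i is uniform on the cones of their Weyl tessellation. *)
Definition weylB_cone_expectation (R : realType) (disp : measure_display)
    (T : measurableType disp) (P : probability T R) (d n : nat)
    (Y : 'I_n -> T -> 'rV[R]_d) (phi : set 'rV[R]_d -> R) : \bar R :=
  'E_P[fun w => weylB_mean (fun i => Y i w) phi].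

(* B[n,k], which vanishes for k outside {0, ..., n}. *)
Definition Bnum (n : nat) (k : int) : int :=
  if k is Posz j then (\prod_(i < n) ('X + (2 * i + 1)%N%:R%:P) : {poly int})`_j
  else 0.

(* D^B(m,k); the terms with i >= k of the sum over all i >= 0 vanish, since
   then m - k + 1 + 2i > m. *)
Definition DB (m k : nat) : int :=
  2 * \sum_(i < k) Bnum m (m%:Z - k%:Z + 1 + 2 * i%:Z).

(* Main.v *)
Require Import Defs.
From HB Require Import structures.
From mathcomp Require Import all_boot all_order all_fingroup all_algebra.
From mathcomp Require Import finmap.
From mathcomp Require Import all_classical all_reals all_analysis.
From mathcomp Require Import measurable_realfun ring lra zify.

Set Implicit Arguments.
Unset Strict Implicit.
Unset Printing Implicit Defensive.

Import Order.TTheory GRing.Theory Num.Theory.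
Import numFieldNormedType.Exports.
Local Open Scope classical_set_scope.
Local Open Scope ring_scope.

(** For vectors in general position the mean number of k-faces over the cones
of the tessellation is one and the same number [weylB_mean_nfaces], so the
expectation is that of an almost surely constant variable. What has to be
counted is the cones, and the pairs formed by a cone and one of its k-faces.

The map sending v to the vector of all <v, y_i> embeds R^d in R^n, and the
cones of the tessellation are the traces on R^d of the Weyl chambers
e_1 x_s(1) > ... > e_n x_s(n) > 0 whose interior meets the image [weylBE].
A k-face of such a cone is obtained by turning d - k of the n inequalities of
its chain into equalities while the others remain strict somewhere, and these
sets of inequalities are in bijection with the k-faces [nfaces_pcone]. So both
counts concern marked signed orders: words in letters +-y_a where a marked
letter is equal to, and an unmarked letter greater than, what follows it.

Both counts are made for words on a set of n labels and a subspace V of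
dimension d in general position, by induction on n.

Without marks, fix a signed order of n - 1 labels that V meets. The 2n ways of
inserting +-y_a are the layers cut out by the 2n - 1 hyperplanes y_a = +-y_b
and y_a = 0, which do not cross each other inside the convex cone of the given
order; hence the number of layers that are not empty is one more than the
number of hyperplanes that traverse the cone ([sheets], [sum_meets_ins]).
General position is inherited by the trace of V on these hyperplanes, so the
number N(n, d) of orders that are met satisfies
  N(n, d) = N(n-1, d) + (2n-1) N(n-1, d-1),
and multiplication by t + 2n - 1 gives the same recursion for D^B
([nmeets0], [DB_nchambers]).

With marks, deleting a marked letter amounts to intersecting V with one of
those hyperplanes, whatever the position of the letter. Counting the words
with r marks together with one of their marks gives
  r T(n, d, r) = 2 n^2 T(n-1, d-1, r-1)
for the number T(n, d, r) of words with r marks that are met [nmeetsS], and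
iterating down to r = 0 yields the formula [nmeets_count]. *)

(** * The scalar product and hyperplanes *)
Section Dot.
Variables (R : realType) (d : nat).
Implicit Types (u v x : 'rV[R]_d) (V : {vspace 'rV[R]_d}).

Lemma dotrE u v : dotr u v = (u *m v^T) 0 0.
Proof. by rewrite mxE; apply: eq_bigr => j _; rewrite mxE. Qed.

Lemma dotrDl u v x : dotr (u + v) x = dotr u x + dotr v x.
Proof. by rewrite !dotrE mulmxDl mxE. Qed.

Lemma dotrZl a u x : dotr (a *: u) x = a * dotr u x.
Proof. by rewrite !dotrE -scalemxAl mxE. Qed.

Lemma dotr0l x : dotr 0 x = 0.
Proof. by rewrite -(scale0r 0) dotrZl mul0r. Qed.

Lemma dotrC u v : dotr u v = dotr v u.
Proof. by apply: eq_bigr => j _; rewrite mulrC. Qed.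

Lemma dotrDr x u v : dotr x (u + v) = dotr x u + dotr x v.
Proof. by rewrite dotrC dotrDl !(dotrC x). Qed.

Lemma dotrZr a x u : dotr x (a *: u) = a * dotr x u.
Proof. by rewrite dotrC dotrZl (dotrC x). Qed.

Lemma dotrNr x u : dotr x (- u) = - dotr x u.
Proof. by rewrite -scaleN1r dotrZr mulN1r. Qed.

Lemma dotrNl x u : dotr (- x) u = - dotr x u.
Proof. by rewrite dotrC dotrNr dotrC. Qed.

Lemma dotrBr x u v : dotr x (u - v) = dotr x u - dotr x v.
Proof. by rewrite dotrDr dotrNr. Qed.

Lemma dotr0r x : dotr x 0 = 0.
Proof. by rewrite dotrC dotr0l. Qed.

Lemma dotr_eq0 x : (dotr x x == 0) = (x == 0).
Proof.
apply/eqP/eqP => [/eqP|->]; last by rewrite dotr0l.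
rewrite psumr_eq0; last by move=> i _; rewrite -expr2 sqr_ge0.
move=> /allP x0; apply/rowP => j; rewrite mxE.
by have := x0 j (mem_index_enum _); rewrite implyTb mulf_eq0 orbb => /eqP.
Qed.

Definition hyperv x : {vspace 'rV[R]_d} :=
  lker (linfun (mulmxr x^T : 'rV[R]_d -> 'rV[R]_1)).

Lemma mem_hyperv v x : (v \in hyperv x) = (dotr v x == 0).
Proof.
rewrite memv_ker lfunE /= dotrE; apply/eqP/eqP => [->|v0]; first by rewrite mxE.
by apply/rowP => i; rewrite ord1 v0 mxE.
Qed.

Lemma dim_cap_hyperv V x : (\dim V <= (\dim (V :&: hyperv x)).+1)%N.
Proof.
rewrite -[leqLHS](limg_ker_dim (linfun (mulmxr x^T : 'rV[R]_d -> 'rV[R]_1)) V).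
rewrite -[leqRHS]addn1 leq_add2l (leq_trans (dimvS (subvf _))) // dimvf.
by rewrite dim_matrix.
Qed.

Lemma hypervN x : hyperv (- x) = hyperv x.
Proof. by apply/vspaceP => v; rewrite !mem_hyperv dotrNr oppr_eq0. Qed.

Lemma hyperv_sign (b : bool) x : hyperv ((-1) ^+ b *: x) = hyperv x.
Proof. by case: b; rewrite ?expr1 ?expr0 ?scaleN1r ?scale1r ?hypervN. Qed.

End Dot.

(** * Marked signed orders *)

(** The letter (a, t, m) stands for the vector (-1)^t y_a. The mark m says how
its value compares with that of the next letter, or with 0 at the end of the
word: equal if m holds, larger otherwise. Words without marks are the chambers
of type B, and a word with r marks is a chamber together with one of its faces
of codimension r. *)
Notation wletter I := (I * bool * bool)%type.

Section Words.
Variables (R : realType) (d : nat) (I : finType) (y : I -> 'rV[R]_d).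
Implicit Types (u v x : 'rV[R]_d) (V : {vspace 'rV[R]_d}).
Implicit Types (l : wletter I) (w : seq (wletter I)) (s : seq I).

Definition label l := l.1.1.
Definition labels w := map label w.
Definition marks w : nat := count snd w.
Definition lval l : 'rV[R]_d := (-1) ^+ l.1.2 *: y (label l).
(** The default 0 makes the last inequality of a chain, the comparison of the
last letter with 0, an instance of the general rule. *)
Definition hval w : 'rV[R]_d := if w is l :: _ then lval l else 0.

(** The relation [rho] used at the letters without mark is a parameter because
the strict order gives the relative interior of a face, and the relation that
always holds gives the linear span cut out by the equalities alone. *)
Fixpoint sat (rho : rel R) v w : bool :=
  if w is l :: w' then
    (if l.2 then dotr v (lval l) == dotr v (hval w')
     else rho (dotr v (hval w')) (dotr v (lval l))) && sat rho v w'
  else true.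

Definition meets V w : bool := `[< exists2 v, v \in V & sat <%R v w >].

Fixpoint kerw w : {vspace 'rV[R]_d} :=
  if w is l :: w' then
    (if l.2 then hyperv (lval l - hval w') :&: kerw w' else kerw w')%VS
  else fullv.

Lemma mem_kerw v w : (v \in kerw w) = sat (fun _ _ => true) v w.
Proof.
elim: w => [|l w IH] /=; first by rewrite memvf.
by case: l.2; rewrite //= memv_cap IH mem_hyperv dotrBr subr_eq0.
Qed.

Definition ins p l w := take p w ++ l :: drop p w.

Lemma perm_ins p l w : perm_eq (ins p l w) (l :: w).
Proof. by rewrite /ins perm_catC cat_cons perm_cons perm_catC cat_take_drop. Qed.

Lemma labels_ins p l w : perm_eq (labels (ins p l w)) (label l :: labels w).
Proof. exact: (perm_map label (perm_ins p l w)). Qed.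

Lemma marks_ins p l w : marks (ins p l w) = (l.2 + marks w)%N.
Proof. by have /seq.permP/(_ snd) := perm_ins p l w. Qed.

(** A marked letter has the value of what follows it, so the letter before it
compares with it exactly as it did before the insertion. *)
Lemma sat_ins rho v p l w : l.2 ->
  sat rho v (ins p l w) =
  (dotr v (lval l) == dotr v (hval (drop p w))) && sat rho v w.
Proof.
move=> l2; rewrite /ins; elim: w p => [|x w IH] [|p] /=; rewrite ?l2 //=.
rewrite IH /=; case: (dotr v (lval l) =P _) => e; rewrite /= ?andbF //.
suff -> : dotr v (hval (take p w ++ l :: drop p w)) = dotr v (hval w) by [].
by case: w p e {IH} => [|z w] [|p].
Qed.

Lemma sum_hval_drop (G : 'rV[R]_d -> nat) w :
  (\sum_(p < (size w).+1) G (hval (drop p w)) =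
   \sum_(l <- w) G (lval l) + G 0%R)%N.
Proof.
elim: w => [|x w IH]; first by rewrite big_ord1 big_nil.
by rewrite big_ord_recl big_cons -addnA -IH.
Qed.

(** Inserting a marked letter cuts V with a hyperplane that depends on the
position only through the letter that follows. *)
Lemma meets_ins_mark V p l w : l.2 ->
  meets V (ins p l w) = meets (V :&: hyperv (lval l - hval (drop p w)))%VS w.
Proof.
move=> l2; apply: asbool_equiv_eq; split.
  move=> [v vV]; rewrite sat_ins // => /andP[e sv]; exists v => //.
  by rewrite memv_cap vV mem_hyperv dotrBr subr_eq0.
move=> [v]; rewrite memv_cap mem_hyperv dotrBr subr_eq0 => /andP[vV e] sv.
by exists v => //; rewrite sat_ins // e.
Qed.

Definition wallB a b (sg : bool) : {vspace 'rV[R]_d} :=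
  hyperv (y a - (-1) ^+ sg *: y b).

(** The relation e y_a = t y_b depends on the two signs through their product,
so summing over the sign of the letter a makes the signs in w disappear. *)
Lemma sum_sign_wall (G : {vspace 'rV[R]_d} -> nat) a m w :
  (\sum_(sg : bool) \sum_(l <- w) G (hyperv (lval (a, sg, m) - lval l)) =
   \sum_(b <- labels w) \sum_(sg : bool) G (wallB a b sg))%N.
Proof.
rewrite exchange_big big_map; apply: eq_bigr => -[[b t] m'] _.
rewrite (reindex_inj (@addbI t)); apply: eq_bigr => sg _.
congr G; rewrite /wallB /lval /=.
rewrite -[in RHS](hyperv_sign (t (+) sg)) scalerBr scalerA -signr_addb.
by rewrite -addbA addbb addbF.
Qed.

(** The insertions of a marked letter +-y_a run once through each hyperplane
y_a = +-y_b, and twice through y_a = 0, which both signs give. *)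
Lemma sum_meets_ins_mark V a w :
  (\sum_(sg : bool) \sum_(p < (size w).+1) meets V (ins p (a, sg, true) w) =
   \sum_(b <- labels w) \sum_(sg : bool) meets (V :&: wallB a b sg) w +
   2 * meets (V :&: hyperv (y a)) w)%N.
Proof.
transitivity (\sum_(sg : bool)
  (\sum_(l <- w) meets (V :&: hyperv (lval (a, sg, true) - lval l)) w +
   meets (V :&: hyperv (y a)) w))%N.
  apply: eq_bigr => sg _.
  rewrite -(hyperv_sign sg (y a)) -[X in hyperv X]subr0.
  rewrite -(sum_hval_drop
    (fun x => meets (V :&: hyperv (lval (a, sg, true) - x)) w : nat)).
  by apply: eq_bigr => p _; rewrite meets_ins_mark.
rewrite big_split /= (sum_sign_wall (fun H => meets (V :&: H) w : nat)).
by rewrite sum_nat_const card_bool.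
Qed.

End Words.

(** * Layers of a convex cone between hyperplanes that do not cross *)
Section Sheets.
Variables (R : realType) (d : nat).
Implicit Types (K : 'rV[R]_d -> Prop) (g x : 'rV[R]_d).

Definition convex_cone K := forall u v a b,
  K u -> K v -> 0 < a -> 0 < b -> K (a *: u + b *: v).

(** A hyperplane that meets the cone has, by hypothesis, points of the cone on
both its sides, and by convexity only such a hyperplane does; so the number of sides it has in
the cone is one, plus one if it meets the cone. *)
Lemma count_sides K x g : convex_cone K -> (exists v, K v) ->
  (forall v, K v -> dotr v g = dotr v x ->
     (exists2 v1, K v1 & dotr v1 x < dotr v1 g) /\
     (exists2 v2, K v2 & dotr v2 g < dotr v2 x)) ->
  (`[< exists2 v, K v & (dotr v x < dotr v g)%R >] +
   `[< exists2 v, K v & (dotr v g < dotr v x)%R >] =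
   `[< exists2 v, K v & (dotr v g = dotr v x)%R >] + 1)%N.
Proof.
move=> cK [v0 Kv0] both.
case: (asboolP (exists2 v, K v & dotr v g = dotr v x)) => [[v Kv e]|nE].
  by have [/asboolT -> /asboolT ->] := both v Kv e.
case: asboolP => [[v Kv gv]|ng]; case: asboolP => [[u Ku gu]|nl] //.
- case: nE; exists ((dotr v g - dotr v x) *: u + (dotr u x - dotr u g) *: v).
    by apply: cK => //; rewrite subr_gt0.
  by rewrite !dotrDl !dotrZl; ring.
- have [lt|lt|e] := ltgtP (dotr v0 g) (dotr v0 x).
  + by case: nl; exists v0.
  + by case: ng; exists v0.
  + by case: nE; exists v0.
Qed.

(** If g exceeds x2 somewhere and is below x1 somewhere, then a suitable
positive combination of the two witnesses lies between x2 and x1. *)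
Lemma count_between K x1 x2 g : convex_cone K -> (exists v, K v) ->
  (forall v, K v -> dotr v x2 < dotr v x1) ->
  (`[< exists2 v, K v & (dotr v x2 < dotr v g < dotr v x1)%R >] + 1 =
   `[< exists2 v, K v & (dotr v x2 < dotr v g)%R >] +
   `[< exists2 v, K v & (dotr v g < dotr v x1)%R >])%N.
Proof.
move=> cK [v0 Kv0] lt21.
case: (asboolP (exists2 v, K v & dotr v x2 < dotr v g)) => [[u Ku gu]|n2];
  case: (asboolP (exists2 v, K v & dotr v g < dotr v x1)) => [[w Kw gw]|n1].
- suff -> : `[< exists2 v, K v & (dotr v x2 < dotr v g < dotr v x1)%R >] by [].
  apply/asboolP.
  have [b1|b1] := ltP (dotr u g) (dotr u x1); first by exists u; rewrite ?gu.
  have [a2|a2] := ltP (dotr w x2) (dotr w g); first by exists w; rewrite ?a2.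
  have := lt21 u Ku; have := lt21 w Kw => h1 h2.
  (* With a = g - x2 and b = x1 - g, the weights b(w) - a(w) for u and
     a(u) - b(u) for w make a and b both equal to a(u) b(w) - a(w) b(u). *)
  exists ((dotr w x1 - dotr w g - (dotr w g - dotr w x2)) *: u +
          (dotr u g - dotr u x2 - (dotr u x1 - dotr u g)) *: w).
    by apply: cK => //; lra.
  rewrite !dotrDl !dotrZl; apply/andP; split; nra.
- case: asboolP => // -[v Kv /andP[_ l]]; case: n1; by exists v.
- case: asboolP => // -[v Kv /andP[l _]]; case: n2; by exists v.
- have [lt|ge] := ltP (dotr v0 x2) (dotr v0 g); first by case: n2; exists v0.
  case: n1; exists v0 => //; exact: le_lt_trans ge (lt21 _ Kv0).
Qed.

Variables (I : finType) (y : I -> 'rV[R]_d).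
Implicit Types (l : wletter I) (w : seq (wletter I)).

(** On K the letters of w are linear forms ordered as in w and positive, and
the insertions of l are the layers between them, down to 0. Each layer between
consecutive forms contributes the number of its two bounds that g can clear,
minus one, by [count_between]; regrouping these contributions form by form and
applying [count_sides] leaves one unit for every form that g meets. Only the
condition g > 0 at the bottom remains, since the layer on top is unbounded. *)
Lemma sheets K l w : marks w = 0%N -> ~~ l.2 -> convex_cone K ->
  (exists v, K v) -> (forall v, K v -> sat y <%R v w) ->
  (forall z v, z \in w -> K v -> dotr v (lval y l) = dotr v (lval y z) ->
     (exists2 v1, K v1 & dotr v1 (lval y z) < dotr v1 (lval y l)) /\
     (exists2 v2, K v2 & dotr v2 (lval y l) < dotr v2 (lval y z))) ->
  (\sum_(p < (size w).+1) `[< exists2 v, K v & sat y <%R v (ins p l w) >] =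
   \sum_(z <- w) `[< exists2 v, K v &
      (dotr v (lval y l) = dotr v (lval y z))%R >] +
   `[< exists2 v, K v & (0 < dotr v (lval y l))%R >])%N.
Proof.
move=> mw l2 cK K0; have nl : l.2 = false by apply/negbTE.
elim: w mw => [|z w IH] mw Ksat both.
  rewrite big_ord1 big_nil add0n /ins /= nl; congr nat_of_bool.
  by apply: asbool_equiv_eq; split=> -[v Kv]; rewrite ?dotr0r ?andbT => h;
    exists v; rewrite ?dotr0r ?andbT.
have nz : z.2 = false by move: mw => /=; case: z.2.
have mw' : marks w = 0%N by move: mw; rewrite /= nz.
have Kz v : K v -> dotr v (hval y w) < dotr v (lval y z) /\ sat y <%R v w.
  by move=> /Ksat; rewrite /= nz => /andP.
rewrite big_cons -addnA -IH //; last 2 first.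
- by move=> v /Kz[].
- by move=> z' v z'w; apply: both; rewrite inE z'w orbT.
rewrite !big_ord_recl.
have h0 : `[< exists2 v, K v & sat y <%R v (ins 0 l (z :: w)) >] =
    `[< exists2 v, K v & (dotr v (lval y z) < dotr v (lval y l))%R >].
  apply: asbool_equiv_eq; split=> -[v Kv]; rewrite /ins /= nl => h; exists v => //.
    by case/andP: h.
  by rewrite h; apply: (Ksat v Kv).
have h1 : `[< exists2 v, K v & sat y <%R v (ins 1 l (z :: w)) >] =
    `[< exists2 v, K v &
         dotr v (hval y w) < dotr v (lval y l) < dotr v (lval y z) >].
  apply: asbool_equiv_eq; split=> -[v Kv]; rewrite /ins /= ?take0 ?drop0 /= ?nl ?nz.
    by move=> /and3P[h h' _]; exists v; rewrite ?h'.
  by move=> /andP[h h']; exists v; rewrite //= ?nz h h'; case: (Kz v Kv).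
have h2 : `[< exists2 v, K v & sat y <%R v (ins 0 l w) >] =
    `[< exists2 v, K v & (dotr v (hval y w) < dotr v (lval y l))%R >].
  apply: asbool_equiv_eq; split=> -[v Kv]; rewrite /ins ?take0 ?drop0 /= ?nl => h.
    by exists v => //; case/andP: h.
  by exists v; rewrite //= ?nl h; case: (Kz v Kv).
have h3 (i : 'I_(size w)) :
    `[< exists2 v, K v & sat y <%R v (ins i.+2 l (z :: w)) >] =
    `[< exists2 v, K v & sat y <%R v (ins i.+1 l w) >].
  have e' : hval y (ins i.+1 l w) = hval y w.
    by rewrite /ins; case: (w) i => [[]|].
  have e : ins i.+2 l (z :: w) = z :: ins i.+1 l w by [].
  apply: asbool_equiv_eq; split=> -[v Kv]; rewrite e /= nz e'.
    by move=> /andP[_ h]; exists v.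
  by move=> h; exists v; rewrite //= ?nz ?e' h andbT; case: (Kz v Kv).
rewrite /= h0 h1 h2; under eq_bigr do rewrite h3.
have hb := count_between (lval y l) cK K0 (fun v Kv => (Kz v Kv).1).
have hs := count_sides cK K0 (fun v Kv => both z v (mem_head z w) Kv).
(* The two sums over the remaining positions are convertible. *)
set S1 := (X in (_ + (_ + X) = _)%N); set S2 := (X in (_ = _ + (_ + X))%N).
by rewrite (_ : S1 = S2) //; move: S2 hb hs; clear; lia.
Qed.

End Sheets.

(** * Inserting a letter into a chamber *)
Section Chambers.
Variables (R : realType) (d : nat) (I : finType) (y : I -> 'rV[R]_d).
Implicit Types (u v x : 'rV[R]_d) (V : {vspace 'rV[R]_d}).
Implicit Types (l : wletter I) (w : seq (wletter I)) (s : seq I).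
Local Notation lval := (lval y).
Local Notation hval := (hval y).
Local Notation sat := (sat y).
Local Notation meets := (meets y).
Local Notation kerw := (kerw y).
Local Notation wallB := (wallB y).

Lemma sat_cone u v a b w : sat <%R u w -> sat <%R v w -> 0 < a -> 0 < b ->
  sat <%R (a *: u + b *: v) w.
Proof.
move=> + + a0 b0; elim: w => [|l w IH] //= /andP[hu su] /andP[hv sv].
rewrite IH // andbT !dotrDl !dotrZl; case: l.2 hu hv => [/eqP-> /eqP->//|hu hv].
by rewrite ltrD // ltr_pM2l.
Qed.

(** Finitely many strict inequalities survive a small step in the direction u. *)
Lemma sat_open u v w : marks w = 0%N -> sat <%R v w ->
  exists2 e0, 0 < e0 & forall e, 0 < e -> e <= e0 -> sat <%R (v + e *: u) w.
Proof.
elim: w => [|l w IH] /=; first by exists 1.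
case: l.2 => //= mw /andP[hl sw]; have [e1 e10 he1] := IH mw sw.
set c := dotr v (lval l) - dotr v (hval w).
set b := dotr u (lval l) - dotr u (hval w).
have c0 : 0 < c by rewrite subr_gt0.
have b1 : 0 < `|b| + 1 by rewrite ltr_wpDl.
(* The step e changes the slack c of the first inequality by e * b, and
   e <= c / (|b| + 1) keeps e |b| below c; the 1 avoids dividing by 0. *)
exists (Num.min e1 (c / (`|b| + 1))); first by rewrite lt_min e10 divr_gt0.
move=> e e0; rewrite le_min => /andP[/(he1 e e0) -> ]; rewrite andbT => le.
rewrite -subr_gt0 !dotrDl !dotrZl.
rewrite (_ : _ - _ = c + e * b); last by rewrite /c /b; ring.
have : e * (`|b| + 1) <= c by rewrite -ler_pdivlMr.
have := ler_norm (- b); rewrite normrN => hb hc.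
by nra.
Qed.

(** A hyperplane through a point of an open chamber of V has points of the
chamber on both sides, unless it contains V. *)
Lemma open_sides V v w g x : marks w = 0%N -> v \in V -> sat <%R v w ->
  dotr v g = dotr v x -> (exists2 u, u \in V & dotr u g != dotr u x) ->
  (exists2 v1, v1 \in V /\ sat <%R v1 w & dotr v1 x < dotr v1 g) /\
  (exists2 v2, v2 \in V /\ sat <%R v2 w & dotr v2 g < dotr v2 x).
Proof.
move=> mw vV sv e0 [u uV hu].
wlog lt : g x e0 hu / dotr u g < dotr u x.
  move=> W; have [lt|lt|eq] := ltgtP (dotr u g) (dotr u x).
  - exact: W.
  - by have [|h1 h2] := W _ _ (esym e0) _ lt; first by rewrite eq_sym.
  - by rewrite eq eqxx in hu.
have [e1 e10 h1] := sat_open u mw sv.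
have [e2 e20 h2] := sat_open (- u) mw sv.
split.
- exists (v + e2 *: - u); first by rewrite memvD ?memvZ ?memvN //; split; [|exact: h2].
  by rewrite !dotrDl !dotrZl e0 ltrD2l ltr_pM2l // !dotrNl ltrN2.
- exists (v + e1 *: u); first by rewrite memvD ?memvZ //; split; [|exact: h1].
  by rewrite !dotrDl !dotrZl e0 ltrD2l ltr_pM2l.
Qed.

Lemma sat_ins_sub v p l w : marks w = 0%N -> ~~ l.2 ->
  sat <%R v (ins p l w) -> sat <%R v w.
Proof.
move=> + /negbTE l2; rewrite /ins.
elim: w p => [|z w IH] [|p] //=; rewrite ?l2 //=; first by move=> _ /andP[].
case: z.2 => //= mw /andP[h hs]; rewrite (IH p) // andbT.
case: w p mw h hs {IH} => [|z' w] [|p] //= _; rewrite l2 => + /andP[+ _].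
- by move=> + h; apply: lt_trans.
- by move=> + h; apply: lt_trans.
- by move=> + h; apply: lt_trans.
Qed.

Lemma meets_cap_hyperv V g x w :
  meets (V :&: hyperv (g - x))%VS w =
  `[< exists2 v, v \in V /\ sat <%R v w & dotr v g = dotr v x >].
Proof.
apply: asbool_equiv_eq; split=> [[v]|[v [vV sv] e]].
  by rewrite memv_cap mem_hyperv dotrBr subr_eq0 => /andP[vV /eqP e] sv; exists v.
by exists v; rewrite // memv_cap vV mem_hyperv dotrBr e subrr eqxx.
Qed.

(** The 2n layers cut out by the 2n - 1 hyperplanes y_a = +-y_b and y_a = 0.
For each sign of the letter a, [sheets] counts the layers with +-y_a > 0; the
two leftover terms, whether y_a can be positive and whether it can be negative,
add up to 1 plus the indicator of y_a = 0 by [count_sides]. *)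
Lemma sum_meets_ins V a w : marks w = 0%N ->
  (exists2 u, u \in V & dotr u (y a) != 0) ->
  (forall b sg, b \in labels w -> exists2 u, u \in V & u \notin wallB a b sg) ->
  (\sum_(sg : bool) \sum_(p < (size w).+1) meets V (ins p (a, sg, false) w) =
   meets V w + \sum_(b <- labels w) \sum_(sg : bool) meets (V :&: wallB a b sg) w
   + meets (V :&: hyperv (y a)) w)%N.
Proof.
move=> mw h0 hb; case: (boolP (meets V w)) => [rw|nrw]; last first.
  have nr (H : {vspace 'rV[R]_d}) : meets (V :&: H) w = false.
    apply: contraNF nrw => /asboolP[v]; rewrite memv_cap => /andP[vV _] sv.
    by apply/asboolP; exists v.
  rewrite nr /= addn0 add0n [RHS]big1; last first.
    by move=> b _; rewrite big1 // => sg _; rewrite nr.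
  rewrite big1 // => sg _; rewrite big1 // => p _.
  apply/eqP; rewrite eqb0; apply: contra nrw => /asboolP[v vV].
  by move=> /(@sat_ins_sub v p (a, sg, false) w mw isT) sv; apply/asboolP; exists v.
pose K v := v \in V /\ sat <%R v w.
have K0 : exists v, K v by case/asboolP: rw => v vV sv; exists v.
have cK : convex_cone K.
  by move=> u v r t [uV su] [vV sv] r0 t0; split;
    [rewrite memvD ?memvZ | apply: sat_cone].
have e1 sg : (\sum_(p < (size w).+1) meets V (ins p (a, sg, false) w) =
    \sum_(z <- w) meets (V :&: hyperv (lval (a, sg, false) - lval z)) w +
    `[< exists2 v, K v & (0 < (-1) ^+ sg * dotr v (y a))%R >])%N.
  transitivity (\sum_(p < (size w).+1)
      `[< exists2 v, K v & sat <%R v (ins p (a, sg, false) w) >])%N.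
    apply: eq_bigr => p _; congr nat_of_bool; apply: asbool_equiv_eq.
    split=> -[v]; last by move=> [vV _] sv; exists v.
    by move=> vV sv; exists v => //; split => //; apply: sat_ins_sub sv.
  rewrite (sheets (K := K)) //; last 2 first.
  - by move=> v [].
  - move=> z v zw [vV sv] e; apply: open_sides e _ => //.
    have [u uV] := hb (label z) (sg (+) z.1.2) (map_f (@label I) zw); rewrite mem_hyperv.
    rewrite dotrBr subr_eq0 dotrZr signr_addb => ne; exists u => //.
    apply: contra ne; rewrite /lval !dotrZr /= => /eqP e'.
    rewrite -mulrA -e' mulrA -signr_addb addbb expr0 mul1r eqxx //.
  congr (_ + nat_of_bool _)%N; last first.
    by apply: asbool_equiv_eq; split=> -[v Kv] h; exists v => //; move: h;
      rewrite /lval dotrZr.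
  by apply: eq_bigr => z _; rewrite meets_cap_hyperv.
rewrite (eq_bigr _ (fun sg _ => e1 sg)) big_split /=.
rewrite (sum_sign_wall y (fun H => meets (V :&: H) w : nat)).
rewrite addnC -addnA [X in _ = (_ + X)%N]addnC addnA; congr (_ + _)%N.
rewrite big_bool /= expr1 expr0 -(subr0 (y a)) meets_cap_hyperv subr0.
have := @count_sides _ _ K 0 (y a) cK K0.
have -> : `[< exists2 v, K v & (0 < -1 * dotr v (y a))%R >] =
          `[< exists2 v, K v & dotr v (y a) < dotr v 0 >].
  by apply: asbool_equiv_eq; split=> -[v Kv] h; exists v => //; move: h;
    rewrite mulN1r oppr_gt0 dotr0r.
have -> : `[< exists2 v, K v & (0 < 1 * dotr v (y a))%R >] =
          `[< exists2 v, K v & dotr v 0 < dotr v (y a) >].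
  by apply: asbool_equiv_eq; split=> -[v Kv] h; exists v => //; move: h;
    rewrite mul1r dotr0r.
rewrite addnC [(1 + _)%N]addnC; apply=> v [vV sv] e; apply: open_sides e _ => //.
by case: h0 => u uV h; exists u => //; rewrite dotr0r.
Qed.

(** The truncated subtraction expresses that r equalities of a chain cut V down
by r dimensions as long as there is something left, including when there are
more labels than dimensions; this makes the notion stable under removing labels
and under intersecting V with the hyperplanes of the arrangement. *)
Definition gen_pos s V := forall w, perm_eq (labels w) s ->
  \dim (V :&: kerw w)%VS = (\dim V - marks w)%N.

Lemma gen_pos_behead a s V : gen_pos (a :: s) V -> gen_pos s V.
Proof.
by move=> g w ws; apply: (g ((a, false, false) :: w)); rewrite /= perm_cons.
Qed.

Lemma gen_pos_perm s s' V : perm_eq s s' -> gen_pos s V -> gen_pos s' V.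
Proof. by move=> ss g w ws; apply: g; rewrite (perm_trans ws) // perm_sym. Qed.

(** If H is the equation added by a marked letter a at a suitable place of any
word w on s, then the equalities of w in V :&: H are those of a longer word in V. *)
Lemma gen_pos_cap a s V (H : {vspace 'rV[R]_d}) : gen_pos (a :: s) V ->
  (forall w, perm_eq (labels w) s -> exists p sg,
     hyperv (lval (a, sg, true) - hval (drop p w)) = H) ->
  \dim (V :&: H)%VS = (\dim V).-1 /\ gen_pos s (V :&: H)%VS.
Proof.
move=> g hH.
have key w : perm_eq (labels w) s ->
    \dim (V :&: H :&: kerw w)%VS = (\dim V - (marks w).+1)%N.
  move=> ws; have [p [sg eH]] := hH w ws.
  have := g (ins p (a, sg, true) w); rewrite marks_ins => <- //; last first.
    by rewrite (perm_trans (labels_ins _ _ _)) //= perm_cons.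
  congr (\dim _); apply/vspaceP => v; rewrite !memv_cap !mem_kerw sat_ins // -eH.
  by rewrite mem_hyperv dotrBr subr_eq0 andbA.
have dH : \dim (V :&: H)%VS = (\dim V).-1.
  (* For the dimension of V :&: H itself, use a word without marks. *)
  pose w0 := [seq (b, false, false) | b <- s].
  have l0 : labels w0 = s by rewrite /labels -map_comp map_id.
  have m0 : marks w0 = 0%N by rewrite /marks count_map; elim: (s).
  have k0 : kerw w0 = fullv by rewrite /w0; elim: (s).
  by have := key w0; rewrite l0 m0 k0 capvf subn1; apply.
by split=> // w ws; rewrite key // dH -subn1 -subnDA.
Qed.

(** The letter a goes immediately before the letter b, with the sign that turns
the equality of the two letters into the equation of the hyperplane. *)
Lemma gen_pos_wall a b sg s V : gen_pos (a :: s) V -> b \in s ->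
  \dim (V :&: wallB a b sg)%VS = (\dim V).-1 /\ gen_pos s (V :&: wallB a b sg)%VS.
Proof.
move=> g bs; apply: (gen_pos_cap g) => w ws.
have bw : b \in labels w by rewrite (perm_mem ws).
have lt : (index b (labels w) < size w)%N.
  by rewrite -(size_map (@label I)) index_mem.
pose z := nth (a, false, false) w (index b (labels w)).
have lz : label z = b by rewrite -[RHS](nth_index a bw) (nth_map (a, false, false)).
exists (index b (labels w)), (z.1.2 (+) sg).
rewrite (drop_nth (a, false, false)) //= -/z /lval lz /=.
rewrite /wallB -[RHS](hyperv_sign (z.1.2 (+) sg)) scalerBr scalerA -signr_addb.
by rewrite -addbA addbb addbF.
Qed.

(** The letter a goes to the end of the word, where its mark says y_a = 0. *)
Lemma gen_pos_wall0 a s V : gen_pos (a :: s) V ->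
  \dim (V :&: hyperv (y a))%VS = (\dim V).-1 /\ gen_pos s (V :&: hyperv (y a))%VS.
Proof.
move=> g; apply: (gen_pos_cap g) => w ws; exists (size w), false.
by rewrite drop_size /= subr0 /lval hyperv_sign.
Qed.

End Chambers.

(** * Sums over all words *)
Section WordSums.
Variable I : finType.
Implicit Types (l : wletter I) (w : seq (wletter I)) (s : seq I).

Definition del p w := take p w ++ drop p.+1 w.

Lemma size_ins p l w : size (ins p l w) = (size w).+1.
Proof. exact: (perm_size (perm_ins p l w)). Qed.

Lemma size_del p w : (p < size w)%N -> size (del p w) = (size w).-1.
Proof. by move=> lt; rewrite size_cat size_drop size_take_min; lia. Qed.

Lemma nth_ins l0 p l w : (p <= size w)%N -> nth l0 (ins p l w) p = l.
Proof. by move=> le; rewrite nth_cat size_takel // ltnn subnn. Qed.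

Lemma insK p l w : (p <= size w)%N -> del p (ins p l w) = w.
Proof.
move=> le; rewrite /del /ins take_size_cat ?size_takel //.
by rewrite drop_cat size_takel // ltnNge leqnSn /= subSn // subnn /= drop0
  cat_take_drop.
Qed.

Lemma delK l0 p w : (p < size w)%N -> ins p (nth l0 w p) (del p w) = w.
Proof.
move=> lt; have st : size (take p w) = p by rewrite size_takel // ltnW.
by rewrite /ins /del take_size_cat // drop_size_cat // -drop_nth ?cat_take_drop.
Qed.

Definition wsum n s (F : seq (wletter I) -> nat) : nat :=
  (\sum_(w : n.-tuple (wletter I) | perm_eq (labels w) s) F w)%N.

(** A word with a distinguished position is the same thing as a letter, a word
on the other labels and a position at which to insert the letter. *)
Lemma wsum_split n s (F : seq (wletter I) -> nat -> nat) :
  (wsum n.+1 s (fun w => \sum_(p < n.+1) F w p) =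
   \sum_(l : wletter I | label l \in s)
     wsum n (rem (label l) s) (fun w => \sum_(p < n.+1) F (ins p l w) p))%N.
Proof.
have insP p l (w : n.-tuple (wletter I)) : size (ins p l w) == n.+1.
  by rewrite size_ins size_tuple.
have delP (w : n.+1.-tuple (wletter I)) (p : 'I_n.+1) : size (del p w) == n.
  by rewrite size_del ?size_tuple.
pose h (q : wletter I * n.-tuple (wletter I) * 'I_n.+1) :=
  (Tuple (insP q.2 q.1.1 q.1.2), q.2).
pose h' (q : n.+1.-tuple (wletter I) * 'I_n.+1) :=
  (tnth q.1 q.2, Tuple (delP q.1 q.2), q.2).
have hK : cancel h h'.
  move=> [[l w] p]; rewrite /h /h' /=; congr (_, _, _).
    by rewrite (tnth_nth l) /= nth_ins // size_tuple -ltnS.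
  by apply: val_inj; rewrite /= insK // size_tuple -ltnS.
have hK' : cancel h' h.
  move=> [w p]; rewrite /h /h' /=; congr (_, _); apply: val_inj => /=.
  by rewrite (tnth_nth (thead w)) delK // size_tuple.
rewrite /wsum pair_big_dep /= (reindex h) /=; last first.
  by apply: onW_bij; exists h'.
rewrite pair_big_dep /= pair_big_dep /=; apply: eq_bigl => -[[l w] p] /=.
rewrite !andbT (permPl (labels_ins p l w)) /=.
have [ls|nls] := boolP (label l \in s).
  by rewrite (permPr (perm_to_rem ls)) perm_cons.
by apply: contraNF nls => /perm_mem <-; rewrite mem_head.
Qed.

Lemma sum_letters (P : pred I) (G : wletter I -> nat) :
  (\sum_(l : wletter I | P (label l)) G l =
   \sum_(a | P a) \sum_(sg : bool) \sum_(m : bool) G (a, sg, m))%N.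
Proof.
rewrite pair_big_dep /= pair_big_dep /=.
by apply: eq_big => [[[a sg] m]|[[a sg] m]]; rewrite /= ?andbT.
Qed.

Lemma wsumD n s (F G : seq (wletter I) -> nat) :
  wsum n s (fun w => F w + G w)%N = (wsum n s F + wsum n s G)%N.
Proof. exact: big_split. Qed.

Lemma eq_wsum n s (F G : seq (wletter I) -> nat) :
  (forall w, perm_eq (labels w) s -> F w = G w) -> wsum n s F = wsum n s G.
Proof. by move=> FG; apply: eq_bigr => w; exact: FG. Qed.

Lemma wsum_sum n s (J : Type) (r : seq J) (F : J -> seq (wletter I) -> nat) :
  wsum n s (fun w => \sum_(j <- r) F j w)%N = (\sum_(j <- r) wsum n s (F j))%N.
Proof. exact: exchange_big. Qed.

Lemma wsum0 n s : wsum n s (fun _ => 0%N) = 0%N.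
Proof. by rewrite /wsum big1. Qed.

(** The case of [wsum_split] where the distinguished position is the one of the
label a, which occurs exactly once in each word. *)
Lemma wsum_cons n a s (F : seq (wletter I) -> nat) : uniq (a :: s) ->
  size s = n ->
  (wsum n.+1 (a :: s) F = \sum_(sg : bool) \sum_(m : bool)
     wsum n s (fun w => \sum_(p < n.+1) F (ins p (a, sg, m) w)))%N.
Proof.
move=> us sn; set l0 : wletter I := (a, false, false).
pose F' w p := ((label (nth l0 w p) == a) * F w)%N.
transitivity (wsum n.+1 (a :: s) (fun w => \sum_(p < n.+1) F' w p)%N).
  apply: eq_bigr => w ws; rewrite /F' -big_distrl /= -[LHS]mul1n; congr (_ * _)%N.
  rewrite -(big_mkord xpredT (fun p => nat_of_bool (label (nth l0 w p) == a))).
  rewrite -{1}(size_tuple w) -(big_nth l0 xpredT (fun l => label l == a : nat)).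
  rewrite -(big_map (@label I) xpredT (fun b => b == a : nat)) (perm_big _ ws).
  by rewrite -big_mkcond sum1_count; have /count_uniq_mem-> := us; rewrite mem_head.
rewrite wsum_split (sum_letters (fun b => b \in a :: s)) (bigD1 a) ?mem_head //=.
rewrite [X in (_ + X)%N]big1 ?addn0 => [|b /andP[bs /negbTE ba]].
  apply: eq_bigr => sg _; apply: eq_bigr => m _; rewrite eqxx.
  apply: eq_wsum => w ws; apply: eq_bigr => p _.
  rewrite /F' nth_ins ?eqxx ?mul1n //.
  by rewrite -(size_map (@label I)) (perm_size ws) sn -ltnS.
rewrite big1 // => sg _; rewrite big1 // => m _.
rewrite -[RHS](wsum0 n (rem b (a :: s))); apply: eq_wsum => w ws.
rewrite big1 // => p _; rewrite /F' nth_ins ?ba //.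
rewrite -(size_map (@label I)) (perm_size ws).
suff -> : size (rem b (a :: s)) = n by rewrite -ltnS.
by rewrite size_rem //= sn.
Qed.

End WordSums.

(** * Counting the words met by a subspace in general position *)
Section Counting.
Variables (R : realType) (d : nat) (I : finType) (y : I -> 'rV[R]_d).
Implicit Types (V : {vspace 'rV[R]_d}) (w : seq (wletter I)) (s : seq I).
Local Notation meets := (meets y).
Local Notation gen_pos := (gen_pos y).

(** The recursion for the number of chambers of type B_n met by a subspace of
dimension d in general position. It differs from D^B for n = 0 only, where there
is one chamber, the point, but D^B depends on the parity of d. *)
Fixpoint nchambers n d : nat :=
  match n, d with
  | 0, _ => 1
  | n'.+1, 0 => 0
  | n'.+1, d'.+1 => nchambers n' d'.+1 + (2 * n').+1 * nchambers n' d'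
  end%N.

Definition nmeets n s V r := wsum n s (fun w => (marks w == r) && meets V w).

Lemma cap_proper V (H : {vspace 'rV[R]_d}) : (0 < \dim V)%N ->
  \dim (V :&: H)%VS = (\dim V).-1 -> exists2 u, u \in V & u \notin H.
Proof.
move=> V0 dH; apply: contrapT => nH; have : (V <= V :&: H)%VS.
  rewrite subv_cap subvv; apply/subvP => u uV; apply: contrapT => /negP uH.
  by apply: nH; exists u.
by move=> /dimvS; rewrite dH; case: (\dim V) V0 => // m _; rewrite ltnn.
Qed.

(** Removing the label a from the words groups them according to the order w of
the other labels; [sum_meets_ins] counts each group, and its hyperplane terms
sum up to counts for the traces of V, where the induction hypothesis applies. *)
Lemma nmeets0 n s V : uniq s -> size s = n -> gen_pos s V ->
  nmeets n s V 0 = nchambers n (\dim V).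
Proof.
elim: n s V => [|n IH] [|a s] V // us sn g.
  rewrite /nmeets /wsum (big_pred1 [tuple]) => [|w]; last by rewrite tuple0.
  suff -> : meets V [tuple] by [].
  by apply/asboolP; exists 0; rewrite ?mem0v.
case: sn => sn; case/andP: (us) => nas us'.
(* On the zero space the inequality at the last letter reads 0 > 0. *)
have [V0|] := posnP (\dim V).
  rewrite V0 /= -[RHS](wsum0 n.+1 (a :: s)); apply: eq_wsum => w ws.
  apply/eqP; rewrite eqb0; apply/negP => /andP[/eqP mw /asboolP[v vV]].
  have : w != [::] by apply/eqP => w0; have := perm_size ws; rewrite w0.
  move: vV; have /eqP -> : V == 0%VS by rewrite -dimv_eq0 V0.
  rewrite memv0 => /eqP->; case: w mw {ws} => //= l w.
  by case: l.2 => //= _ _; rewrite !dotr0l ltxx.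
move=> V0; have wallP b sg : b \in s -> _ := @gen_pos_wall _ _ _ _ a b sg s V g.
have [d0 g0] := gen_pos_wall0 g.
rewrite /nmeets (wsum_cons _ us sn).
transitivity (wsum n s (fun w => (marks w == 0) * (meets V w +
   \sum_(b <- s) \sum_(sg : bool) meets (V :&: wallB y a b sg) w +
   meets (V :&: hyperv (y a)) w))%N).
  transitivity (\sum_(sg : bool) wsum n s (fun w => \sum_(p < n.+1)
      ((marks w == 0) && meets V (ins p (a, sg, false) w)))%N).
    apply: eq_bigr => sg _; rewrite big_bool /= [X in (X + _)%N](_ : _ = 0%N).
      by rewrite add0n; apply: eq_wsum => w _; apply: eq_bigr => p _;
        rewrite marks_ins.
    rewrite -[RHS](wsum0 n s); apply: eq_wsum => w _; rewrite big1 // => p _.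
    by rewrite marks_ins.
  rewrite -wsum_sum; apply: eq_wsum => w ws.
  case: eqP => [mw|_]; last by rewrite mul0n big1 // => sg _; rewrite big1.
  have sw : size w = n by rewrite -(size_map (@label I)) (perm_size ws).
  rewrite mul1n -(perm_big _ ws) /= -sw sum_meets_ins //.
  - have [u uV] := cap_proper V0 d0; rewrite mem_hyperv; by exists u.
  - move=> b sg; rewrite (perm_mem ws) => bs.
    by have [dw _] := wallP b sg bs; apply: cap_proper V0 dw.
have nmeetsE U : nmeets n s U 0 = wsum n s (fun w => (marks w == 0) * meets U w)%N.
  by apply: eq_wsum => w _; rewrite mulnb.
transitivity (nmeets n s V 0 +
   \sum_(b <- s) \sum_(sg : bool) nmeets n s (V :&: wallB y a b sg) 0 +
   nmeets n s (V :&: hyperv (y a)) 0)%N.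
  rewrite !nmeetsE; under [in RHS]eq_bigr do
    under eq_bigr do rewrite nmeetsE.
  under [in RHS]eq_bigr do rewrite -wsum_sum.
  rewrite -wsum_sum -!wsumD; apply: eq_wsum => w _; rewrite !mulnDr big_distrr.
  by congr (_ + _ + _)%N; apply: eq_bigr => b _; rewrite big_distrr.
rewrite (IH s V us' sn (gen_pos_behead g)) (IH s _ us' sn g0) d0.
rewrite big_seq (eq_bigr (fun _ => 2 * nchambers n (\dim V).-1))%N; last first.
  move=> b bs; rewrite (eq_bigr (fun _ => nchambers n (\dim V).-1)) => [|sg _].
    by rewrite sum_nat_const card_bool.
  by have [dw gw] := wallP b sg bs; rewrite (IH s _ us' sn gw) dw.
rewrite -big_seq big_const_seq count_predT iter_addn_0 sn.
by case: (\dim V) V0 => //= m _; ring.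
Qed.

(** Double counting of the pairs of a word with r + 1 marks and one of its
marks: delete the marked letter and cut V with the hyperplane it encodes. *)
Lemma nmeetsS n s V r : uniq s -> size s = n.+1 ->
  (r.+1 * nmeets n.+1 s V r.+1 =
   \sum_(a <- s)
     (\sum_(b <- rem a s) \sum_(sg : bool)
        nmeets n (rem a s) (V :&: wallB y a b sg) r +
      2 * nmeets n (rem a s) (V :&: hyperv (y a)) r))%N.
Proof.
move=> us sn.
have [a0 _] : exists a, a \in s by case: (s) sn => // a s' _; exists a; rewrite mem_head.
set l0 : wletter I := (a0, false, false).
pose F w p := ((nth l0 w p).2 * ((marks w == r.+1) && meets V w))%N.
transitivity (wsum n.+1 s (fun w => \sum_(p < n.+1) F w p)%N).
  rewrite /nmeets /wsum big_distrr; apply: eq_bigr => w _ /=.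
  rewrite /F -big_distrl /=.
  have [mw|] := eqVneq (marks w) r.+1; last by rewrite !muln0.
  congr (_ * _)%N; rewrite -mw /marks -sum1_count big_mkcond.
  rewrite (big_nth l0) size_tuple big_mkord.
  by apply: eq_bigr => p _; case: (_.2).
rewrite wsum_split (sum_letters (mem s)) -big_uniq //=.
rewrite !big_seq; apply: eq_bigr => a a_s.
have sr : size (rem a s) = n by rewrite size_rem // sn.
have nmeetsE U : nmeets n (rem a s) U r =
    wsum n (rem a s) (fun w => (marks w == r) * meets U w)%N.
  by apply: eq_wsum => w _; rewrite mulnb.
rewrite !nmeetsE; under [in RHS]eq_bigr do under eq_bigr do rewrite nmeetsE.
under [in RHS]eq_bigr do rewrite -wsum_sum.
rewrite -wsum_sum mul2n -addnn -!wsumD.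
transitivity (\sum_(sg : bool) wsum n (rem a s) (fun w =>
   \sum_(p < n.+1) (marks w == r) * meets V (ins p (a, sg, true) w)))%N.
  apply: eq_bigr => sg _; rewrite big_bool /= [X in (_ + X)%N](_ : _ = 0%N).
    rewrite addn0; apply: eq_wsum => w ws; apply: eq_bigr => p _.
    rewrite /F nth_ins ?marks_ins /= ?mul1n ?mulnb //.
    by rewrite -(size_map (@label I)) (perm_size ws) sr -ltnS.
  rewrite -[RHS](wsum0 n (rem a s)); apply: eq_wsum => w ws.
  rewrite big1 // => p _; rewrite /F nth_ins //.
  by rewrite -(size_map (@label I)) (perm_size ws) sr -ltnS.
rewrite -wsum_sum; apply: eq_wsum => w ws.
have sw : size w = n by rewrite -(size_map (@label I)) (perm_size ws).
under eq_bigr do rewrite -big_distrr /=.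
have sm := sum_meets_ins_mark y V a w; rewrite sw in sm.
rewrite -big_distrr /= sm (perm_big _ ws) /=.
rewrite mulnDr mulnA [(_ * 2)%N]mulnC -mulnA mul2n -addnn big_distrr /=.
by congr (_ + _)%N; apply: eq_bigr => b _; rewrite big_distrr.
Qed.

(** Iterating [nmeetsS], with 2 (n - 1) walls y_a = +-y_b for each of n labels a
and the wall y_a = 0 counted twice, hence 2 n^2 terms at each step; the factorial
on the left avoids a quotient of natural numbers. *)
Lemma nmeets_count r n s V : (r <= n)%N -> uniq s -> size s = n -> gen_pos s V ->
  (nmeets n s V r * (n - r)`! =
   2 ^ r * 'C(n, r) * n`! * nchambers (n - r) (\dim V - r))%N.
Proof.
elim: r n s V => [|r IH] n s V.
  by move=> _ us sn g; rewrite nmeets0 // !subn0 bin0 expn0 !mul1n mulnC.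
case: n => // n rn us sn g; rewrite subSS.
set X := (2 ^ r * 'C(n, r) * n`! * nchambers (n - r) (\dim V - r.+1))%N.
have sub a U : a \in s -> \dim U = (\dim V).-1 -> gen_pos (rem a s) U ->
    (nmeets n (rem a s) U r * (n - r)`! = X)%N.
  move=> a_s dU gU; rewrite IH //; first by rewrite dU -subn1 -subnDA.
    exact: rem_uniq.
  by rewrite size_rem // sn.
have key : (r.+1 * (nmeets n.+1 s V r.+1 * (n - r)`!) = n.+1 * (2 * n.+1 * X))%N.
  rewrite mulnA nmeetsS // big_distrl /=.
  rewrite big_seq (eq_bigr (fun _ => 2 * n.+1 * X))%N => [|a a_s].
    by rewrite -big_seq big_const_seq count_predT iter_addn_0 sn mulnC.
  have ga : gen_pos (a :: rem a s) V by apply: gen_pos_perm g; apply: perm_to_rem.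
  have [d0 g0] := gen_pos_wall0 ga.
  rewrite mulnDl -mulnA (sub a) // big_distrl /=.
  rewrite big_seq (eq_bigr (fun _ => 2 * X))%N => [|b bs].
    rewrite -big_seq big_const_seq count_predT iter_addn_0 size_rem // sn /=.
    by ring.
  rewrite big_distrl /= (eq_bigr (fun _ => X)) => [|sg _].
    by rewrite sum_nat_const card_bool.
  by have [dw gw] := gen_pos_wall sg ga bs; rewrite sub.
apply/eqP; rewrite -(eqn_pmul2l (ltn0Sn r)) key; apply/eqP.
transitivity (2 * 2 ^ r * (r.+1 * 'C(n.+1, r.+1)) * (n.+1 * n`!) *
  nchambers (n - r) (\dim V - r.+1))%N; last by rewrite expnS factS; ring.
by rewrite -mul_bin_diag /X; ring.
Qed.

End Counting.

(** * The recursion for the numbers D^B *)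
Section StirlingNumbersB.

Lemma BnumS n (j : int) :
  Bnum n.+1 j = Bnum n (j - 1) + (2 * n + 1)%N%:Z * Bnum n j.
Proof.
rewrite /Bnum; case: j => [j|j] /=; last by rewrite mulr0 addr0; case: j.
rewrite big_ord_recr /= mulrDr coefD coefMX coefMC mulrC.
rewrite -[in RHS](intz (2 * n + 1)%N) -pmulrn.
case: j => [|j] /=; first by rewrite mulrC.
by rewrite subn1 /= [in RHS]mulrC mulrC.
Qed.

Lemma Bnum0 (j : int) : Bnum 0 j = (j == 0)%:Z.
Proof. by rewrite /Bnum big_ord0; case: j => // j; rewrite coef1 natz. Qed.

Lemma Bnum_gt n (j : int) : (n%:Z < j)%R -> Bnum n j = 0.
Proof.
elim: n j => [|n IH] j lt; first by rewrite Bnum0 gt_eqF.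
by rewrite BnumS !IH ?mulr0 //; lia.
Qed.

(** The sum defining D^B takes every other coefficient, starting at m - k + 1.
Both shifts coming from [BnumS] respect this pattern; the surplus term with
i = d has an index above n. *)
Lemma DBS n d : DB n.+1 d.+1 = DB n d.+1 + (2 * n + 1)%N%:Z * DB n d.
Proof.
rewrite /DB mulrCA -mulrDr; congr (_ * _).
rewrite (eq_bigr _ (fun i _ => BnumS n _)) big_split /= -mulr_sumr.
congr (_ + _ * _); first by apply: eq_bigr => i _; congr Bnum; lia.
rewrite big_ord_recr /= [X in _ + X]Bnum_gt ?addr0; last by lia.
by apply: eq_bigr => i _; congr Bnum; lia.
Qed.

Lemma DB_0 n : DB n 0 = 0.
Proof. by rewrite /DB big_ord0 mulr0. Qed.

(** D^B(0, d) is 2 for odd d and 0 for even d, so that two consecutive values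
add up to the number of chambers of B_1. *)
Lemma DB0_consecutive d : DB 0 d.+1 + DB 0 d = 2.
Proof.
have DB02 e : DB 0 e.+2 = DB 0 e.
  rewrite /DB; congr (_ * _); under eq_bigr do rewrite Bnum0.
  rewrite big_ord_recl [X in X + _ = _](_ : _ = 0) ?add0r; last first.
    by rewrite (_ : (_ == 0 :> int) = false) //; apply/negP => /eqP; lia.
  rewrite big_ord_recr [X in _ + X = _](_ : _ = 0) ?addr0 /=; last first.
    by rewrite (_ : (_ == 0 :> int) = false) // /bump; apply/negP => /eqP; lia.
  apply: eq_bigr => i _; rewrite Bnum0; congr (Posz (nat_of_bool _)).
  by rewrite /= /bump; apply/eqP/eqP; lia.
elim: d => [|d IH]; last by rewrite DB02 addrC.
by rewrite DB_0 addr0 /DB big_ord1 Bnum0.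
Qed.

Lemma DB_nchambers n d : (0 < n)%N -> DB n d = nchambers n d.
Proof.
elim: n d => // n IH [|d] _; first by rewrite DB_0.
rewrite DBS; case: n IH => [|n] IH; first by rewrite mul1r DB0_consecutive.
by rewrite !IH // -PoszM -PoszD addn1.
Qed.

End StirlingNumbersB.

(** * Words as signed permutations with a set of equalities *)
Section ChainWords.
Variables (R : realType) (d n : nat) (y : 'I_n -> 'rV[R]_d).
Implicit Types (e : {ffun 'I_n -> bool}) (s : {perm 'I_n}) (J : {set 'I_n}).
Implicit Types (v : 'rV[R]_d) (V : {vspace 'rV[R]_d}).
Local Notation c := (chain_vec y).

Definition word e s J : n.-tuple (wletter 'I_n) :=
  [tuple (s i, e i, i \in J) | i < n].

Lemma labels_word e s J : perm_eq (labels (word e s J)) (enum 'I_n).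
Proof.
rewrite /labels -map_comp; apply: uniq_perm; rewrite ?enum_uniq //.
  by rewrite map_inj_uniq ?val_ord_tuple ?enum_uniq //; apply: perm_inj.
move=> i; rewrite mem_enum [RHS]inE; apply/mapP; exists ((s^-1)%g i).
  by rewrite val_ord_tuple mem_enum.
by rewrite /= permKV.
Qed.

Lemma marks_word e s J : marks (word e s J) = #|J|.
Proof.
rewrite /marks count_map val_ord_tuple enumT cardE [in RHS]/enum_mem size_filter.
exact: eq_count.
Qed.

Lemma word_inj e e' s s' J J' : word e s J = word e' s' J' ->
  [/\ e = e', s = s' & J = J'].
Proof.
move=> eq; have E i : (s i, e i, i \in J) = (s' i, e' i, i \in J').
  by have := congr1 (fun t => tnth t i) eq; rewrite !tnth_mktuple.
by split; [apply/ffunP|apply/permP|apply/setP] => i; case: (E i).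
Qed.

Lemma word_surj (w : n.-tuple (wletter 'I_n)) :
  perm_eq (labels w) (enum 'I_n) -> exists e s J, w = word e s J.
Proof.
move=> lw; have inj : injective (fun i => label (tnth w i)).
  move=> i j; have : uniq (labels w) by rewrite (perm_uniq lw) enum_uniq.
  have l0 := tnth w i; rewrite !(tnth_nth l0) => /uniqP u.
  rewrite -!(nth_map l0 i) ?size_tuple // => /u; rewrite !inE size_map size_tuple.
  by move=> /(_ (ltn_ord i) (ltn_ord j)) /ord_inj.
exists [ffun i => (tnth w i).1.2], (perm inj), [set i | (tnth w i).2]%SET.
apply: eq_from_tnth => i; rewrite tnth_mktuple permE ffunE inE /label.
by case: (tnth w i) => -[].
Qed.

Lemma sat_nth rho v (w : seq (wletter 'I_n)) l0 :
  sat y rho v w <-> forall i, (i < size w)%N ->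
   let h := dotr v (nth 0 (map (lval y) w) i.+1) in
   let l := nth l0 w i in
   if l.2 then dotr v (lval y l) == h else rho h (dotr v (lval y l)).
Proof.
elim: w => [|l w IH]; first by split.
have -> : sat y rho v (l :: w) =
    (if l.2 then dotr v (lval y l) == dotr v (hval y w)
     else rho (dotr v (hval y w)) (dotr v (lval y l))) && sat y rho v w by [].
have -> : hval y w = nth 0 (map (lval y) w) 0 by case: (w).
split=> [/andP[h /IH hw] [|i]|h]; [by []|exact: hw|].
by apply/andP; split; [apply: (h 0%N) | apply/IH => i; apply: (h i.+1)].
Qed.

Lemma sat_word rho v e s J :
  sat y rho v (word e s J) <-> forall i : 'I_n,
   let h := dotr v (oapp (fun j => (-1) ^+ e j *: y (s j)) 0 (insub i.+1)) in
   let x := dotr v ((-1) ^+ e i *: y (s i)) in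
   if i \in J then x == h else rho h x.
Proof.
have nxt (i : 'I_n) : nth 0 (map (lval y) (word e s J)) i.+1 =
    oapp (fun j => (-1) ^+ e j *: y (s j)) 0 (insub i.+1).
  case: insubP => [j _ ji|].
    have lt : (i.+1 < size (word e s J))%N by rewrite size_tuple -ji; exact: ltn_ord.
    rewrite (nth_map (s i, e i, false)) // -ji -(tnth_nth _ (word e s J) j).
    by rewrite tnth_mktuple.
  by rewrite -leqNgt => le; rewrite nth_default // size_map size_tuple.
case: (pickP (xpredT : pred 'I_n)) => [i0 _|n0]; last first.
  split=> [_ i|_]; first by have := n0 i.
  by case: (word e s J) => -[|l w] //= _; have := n0 (label l).
have l0 : wletter 'I_n := (i0, false, false).
have wE (i : 'I_n) : nth l0 (word e s J) i = (s i, e i, i \in J).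
  by rewrite -tnth_nth tnth_mktuple.
split=> [/sat_nth h i|h].
  by have := h l0 i; rewrite size_tuple wE nxt => /(_ (ltn_ord i)).
apply/(sat_nth _ _ _ l0) => i; rewrite size_tuple => lt.
by rewrite (wE (Ordinal lt)) (nxt (Ordinal lt)); exact: (h (Ordinal lt)).
Qed.

Lemma sat_word_lt v e s J : sat y <%R v (word e s J) <->
  forall i, if i \in J then dotr v (c e s i) = 0 else 0 < dotr v (c e s i).
Proof.
split=> [/sat_word h i|h].
  have := h i; rewrite /chain_vec dotrBr /=; case: (i \in J) => [/eqP ->|].
    by rewrite subrr.
  by rewrite subr_gt0.
apply/sat_word => i; have := h i; rewrite /chain_vec dotrBr /=.
by case: (i \in J) => [/eqP|]; rewrite ?subr_eq0 ?subr_gt0.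
Qed.

Definition realized e s J := meets y fullv (word e s J).

Lemma realizedP e s J : realized e s J <-> exists v,
  forall i, if i \in J then dotr v (c e s i) = 0 else 0 < dotr v (c e s i).
Proof.
split=> [/asboolP[v _ /sat_word_lt h]|[v h]]; first by exists v.
by apply/asboolP; exists v; rewrite ?memvf //; apply/sat_word_lt.
Qed.

Lemma mem_kerw_word v e s J : reflect
  (forall i, i \in J -> dotr v (c e s i) = 0) (v \in kerw y (word e s J)).
Proof.
rewrite mem_kerw; apply: (iffP idP) => [/sat_word h i iJ|h].
  by have := h i; rewrite /= iJ /chain_vec dotrBr => /eqP->; rewrite subrr.
apply/sat_word => i /=; case: ifP => // iJ; rewrite -subr_eq0.
by have := h i iJ; rewrite /chain_vec dotrBr => ->.
Qed.

(** Since [word] is injective and its values are all the words on 'I_n, sums over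
words become sums over triples of signs, a permutation and a set of marks. *)
Lemma nmeets_word V r :
  nmeets y n (enum 'I_n) V r =
  (\sum_(t : {ffun 'I_n -> bool} * {perm 'I_n} * {set 'I_n} | #|t.2| == r)
     meets y V (word t.1.1 t.1.2 t.2))%N.
Proof.
pose h (t : {ffun 'I_n -> bool} * {perm 'I_n} * {set 'I_n}) :=
  word t.1.1 t.1.2 t.2.
pose t0 : {ffun 'I_n -> bool} * {perm 'I_n} * {set 'I_n} :=
  ([ffun=> false], 1%g, finset.set0).
pose h' w := odflt t0 [pick t | h t == w].
have hK : cancel h h'.
  move=> t; rewrite /h'; case: pickP => [t' /eqP e|/(_ t)]; last by rewrite eqxx.
  by case: t t' e => [[e s] J] [[e' s'] J']; rewrite /h /= => /word_inj [-> -> ->].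
rewrite /nmeets /wsum (reindex h) /=; last first.
  exists h' => [t _|w]; first exact: hK.
  by rewrite inE => /word_surj[e [s [J ->]]]; rewrite -[word _ _ _]/(h (e, s, J)) hK.
rewrite [RHS]big_mkcond /=; apply: eq_big => [t|t _].
  by rewrite labels_word.
by rewrite marks_word; case: eqP.
Qed.

End ChainWords.

(** * General position of type B *)
Section GeneralPosition.
Variables (R : realType) (d : nat).
Implicit Types (X : seq 'rV[R]_d) (V : {vspace 'rV[R]_d}).

Definition orthv X : {vspace 'rV[R]_d} := (\bigcap_(x <- X) hyperv x)%VS.

Lemma mem_orthv v X : reflect (forall x, x \in X -> dotr v x = 0) (v \in orthv X).
Proof.
rewrite /orthv; elim: X => [|x X IH]; first by rewrite big_nil memvf; constructor.
rewrite big_cons memv_cap mem_hyperv; apply: (iffP andP).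
  by move=> [/eqP vx /IH h] z; rewrite inE => /predU1P[->|/h].
move=> h; split; first by rewrite h ?mem_head.
by apply/IH => z zX; apply: h; rewrite inE zX orbT.
Qed.

(** Each equation lowers the dimension by at most one. *)
Lemma dim_cap_orthv V X : (\dim V <= \dim (V :&: orthv X) + size X)%N.
Proof.
rewrite /orthv; elim: X V => [|x X IH] V; first by rewrite big_nil capvf addn0.
by rewrite big_cons capvA addnS (leq_trans (dim_cap_hyperv V x)) // ltnS IH.
Qed.

Lemma dim_rV : \dim {: 'rV[R]_d} = d.
Proof. by rewrite dimvf dim_matrix mul1r. Qed.

(** A vector orthogonal to a basis is orthogonal to itself. *)
Lemma orthv_free X : free X -> size X = d -> orthv X = 0%VS.
Proof.
move=> fX sX; apply/eqP; rewrite -subv0; apply/subvP => v /mem_orthv h.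
have sp : <<X>>%VS = fullv.
  by apply/eqP; rewrite eqEdim subvf /= dim_rV (eqP fX) sX.
have : (<<X>> <= hyperv v)%VS.
  by apply/span_subvP => x xX; rewrite mem_hyperv dotrC h.
rewrite sp => /subvP/(_ v (memvf v)); rewrite mem_hyperv dotr_eq0 => /eqP ->.
exact: mem0v.
Qed.

(** Any #|J| chain vectors can be completed to, or contain, a list T of d of
them, whose common orthogonal is 0. Each of the equations lowers the dimension by
at most one, and the d equations of T bring it from d down to 0, so each of them
lowers it by exactly one. *)
Lemma gen_pos_typeB n (y : 'I_n -> 'rV[R]_d) :
  typeB_general_position y -> gen_pos y (enum 'I_n) fullv.
Proof.
move=> [dn gen] w lw.
have sw : size w == n by rewrite -(size_map (@label 'I_n)) (perm_size lw) size_enum_ord.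
have [e [s [J wE]]] := word_surj (w := Tuple sw) lw.
have {wE lw sw} -> : w = word e s J by rewrite -wE.
rewrite marks_word capfv dim_rV.
pose T := take d (enum J ++ enum (~: J)).
have uT : uniq T.
  apply: take_uniq; rewrite cat_uniq !enum_uniq andbT /=; apply/hasPn => i.
  by rewrite !mem_enum inE.
have sT : size T = d by rewrite size_takel // size_cat -!cardE cardsC card_ord.
have oT : orthv [seq chain_vec y e s i | i <- T] = 0%VS.
  apply: orthv_free; last by rewrite size_map.
  have := gen e s [set i in T]%SET; rewrite cardsE (card_uniqP uT) => /(_ sT).
  rewrite (perm_free (Y := [seq chain_vec y e s i | i <- T])) //.
  apply: perm_map; apply: uniq_perm; rewrite ?enum_uniq // => i.
  by rewrite mem_enum inE.
have kJ : kerw y (word e s J) = orthv [seq chain_vec y e s i | i <- enum J].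
  apply/vspaceP => v; apply/mem_kerw_word/mem_orthv => h.
    by move=> x /mapP[i]; rewrite mem_enum => iJ ->; apply: h.
  by move=> i iJ; apply: h; apply: map_f; rewrite mem_enum.
rewrite kJ; have [Jd|dJ] := leqP #|J| d; last first.
  rewrite (eqP (ltnW dJ)).
  suff : (orthv [seq chain_vec y e s i | i <- enum J] <= 0)%VS.
    by rewrite subv0 => /eqP ->; rewrite dimv0.
  rewrite -oT; apply/subvP => v /mem_orthv h; apply/mem_orthv => x.
  move=> /mapP[i iT ->]; apply: h; apply: map_f; move: iT.
  by rewrite /T take_cat -cardE dJ => /mem_take.
set V := orthv _; apply/eqP; rewrite eqn_leq; apply/andP; split; last first.
  have := dim_cap_orthv fullv [seq chain_vec y e s i | i <- enum J].
  by rewrite capfv dim_rV size_map -cardE leq_subLR addnC.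
have TE : T = enum J ++ take (d - #|J|) (enum (~: J)).
  by rewrite /T take_cat -cardE ltnNge Jd.
have := dim_cap_orthv V [seq chain_vec y e s i | i <- take (d - #|J|) (enum (~: J))].
have -> : (V :&: orthv [seq chain_vec y e s i | i <- take (d - #|J|) (enum (~: J))])%VS
  = 0%VS.
  by rewrite -oT TE map_cat /V /orthv big_cat.
rewrite dimv0 add0n => /leq_trans; apply; rewrite size_map.
by move: sT; rewrite TE size_cat -cardE => /(congr1 (subn^~ #|J|)); rewrite addKn => ->.
Qed.

End GeneralPosition.

(** * Counting and summing over a finite set of sets *)
Section FiniteImages.
Variables (T : finType) (U : choiceType) (f : T -> U) (P : pred T) (S : set U).
Hypothesis f_inj : {in P &, injective f}.
Hypothesis SE : S = [set f x | x in [set x | P x]].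

Lemma sum_fset_image (M : nmodType) (phi : U -> M) :
  \sum_(C <- fset_set S) phi C = \sum_(x | P x) phi (f x).
Proof.
have Sfin : finite_set S by rewrite SE; apply: finite_image.
transitivity (\sum_(x <- enum P) phi (f x)); last by rewrite big_enum.
rewrite -(big_map f xpredT) /=; apply: perm_big.
apply: uniq_perm; rewrite ?fset_uniq //.
  rewrite map_inj_in_uniq ?enum_uniq // => x x'; rewrite !mem_enum.
  exact: f_inj.
move=> C; rewrite in_fset_set // SE; apply/idP/mapP => [|[x]].
  by rewrite inE => -[x Px <-]; exists x; rewrite // mem_enum.
by rewrite mem_enum => Px ->; rewrite inE; exists x.
Qed.

Lemma card_fset_image : #|` fset_set S| = #|P|.
Proof.
by rewrite -sum1_card -(sum_fset_image (fun=> 1%N)) [RHS]sum1_size.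
Qed.

Lemma fsum_image (M : nmodType) (phi : U -> M) :
  \sum_(C \in S) phi C = \sum_(x | P x) phi (f x).
Proof.
rewrite fsbig_finite ?sum_fset_image //.
by rewrite SE; apply: finite_image.
Qed.

End FiniteImages.

(** * Faces of a polyhedral cone *)
Section Cones.
Variables (R : realType) (d n : nat) (c : 'I_n -> 'rV[R]_d).
Implicit Types (u v : 'rV[R]_d) (J : {set 'I_n}) (F : set 'rV[R]_d).

Definition pcone : set 'rV[R]_d := [set v | forall i, 0 <= dotr v (c i)].
Definition pface J : set 'rV[R]_d :=
  [set v | pcone v /\ forall i, i \in J -> dotr v (c i) = 0].
Definition rel_interior J v : Prop :=
  forall i, if i \in J then dotr v (c i) = 0 else 0 < dotr v (c i).
Definition facet_space J : {vspace 'rV[R]_d} := orthv [seq c i | i <- enum J].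

Lemma mem_facet_space v J :
  reflect (forall i, i \in J -> dotr v (c i) = 0) (v \in facet_space J).
Proof.
apply: (iffP (mem_orthv _ _)) => h.
  by move=> i iJ; apply: h; apply: map_f; rewrite mem_enum.
by move=> x /mapP[i]; rewrite mem_enum => iJ ->; apply: h.
Qed.

Lemma rel_interior_pface J v : rel_interior J v -> pface J v.
Proof.
move=> h; split=> i; first by have := h i; case: ifP => _ => [->|/ltW].
by have := h i; case: ifP.
Qed.

(** Far enough along a point p of the relative interior of a face, one may move
by v or by -v without leaving the face. *)
Lemma rel_interior_absorb J p v : rel_interior J p -> v \in facet_space J ->
  exists M, pface J (M *: p + v) /\ pface J (M *: p - v).
Proof.
move=> hp /mem_facet_space hv.
(* For i in J the quotient is 0 / 0 = 0, so the sum bounds the ratios at all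
   the strict inequalities. *)
exists (\sum_i `|dotr v (c i)| / dotr p (c i)).
have p0 i : 0 <= dotr p (c i) by have [h _] := rel_interior_pface hp; apply: h.
set M := \sum_i _.
have key i : `|dotr v (c i)| <= M * dotr p (c i).
  have := hp i; case: ifP => iJ; first by rewrite (hv i iJ) => ->; rewrite normr0 mulr0.
  move=> pi; rewrite -ler_pdivrMr // /M (bigD1 i) //= lerDl.
  by apply: sumr_ge0 => j _; rewrite divr_ge0.
have z i : i \in J -> dotr p (c i) = 0 by have := hp i; case: ifP.
split; split=> i; rewrite dotrDl ?dotrNl dotrZl => *.
- by have := key i; have := ler_norm (- dotr v (c i)); rewrite normrN; lra.
- by rewrite z // hv // mulr0 addr0.
- by have := key i; have := ler_norm (dotr v (c i)); lra.
- by rewrite z // hv // mulr0 subr0.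
Qed.

Lemma pface_is_face J : (forall i, c i != 0) -> is_face pcone (pface J).
Proof.
move=> c0; exists n, (fun i => - c i), J; split=> [i||].
- by rewrite oppr_eq0.
- by apply/seteqP; split=> v h i; have := h i; rewrite dotrNr oppr_le0.
- apply/seteqP; split=> v [h1 h2]; split=> i.
  + by have := h1 i; rewrite dotrNr oppr_le0.
  + by move=> iJ; rewrite dotrNr h2 ?oppr0.
  + by have := h1 i; rewrite dotrNr oppr_le0.
  + by move=> /h2 /eqP; rewrite dotrNr oppr_eq0 => /eqP.
Qed.

Lemma dotr_suml (I : Type) (r : seq I) (f : I -> 'rV[R]_d) x :
  dotr (\sum_(i <- r) f i) x = \sum_(i <- r) dotr (f i) x.
Proof.
by elim/big_ind2: _ => [|u a v b <- <-|//]; rewrite ?dotr0l ?dotrDl.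
Qed.

(** Let F be a face for some other presentation a of the cone, and J the set of
the c_i that vanish on F. Adding up witnesses gives a point p of F at which the
other c_i are positive. For v in the cone with c_J(v) = 0, the point M p - v is
still in the cone for large M, so a form a_i that vanishes at p and is nonpositive
on the cone takes nonpositive values at both v and -v; thus v is in F. *)
Lemma is_face_pface F : is_face pcone F ->
  exists J, (exists p, rel_interior J p) /\ F = pface J.
Proof.
move=> [m [a [K [_ CE FE]]]].
have FC v : F v -> pcone v by rewrite FE CE => -[].
pose J := [set i | `[< forall u, F u -> dotr u (c i) = 0 >]]%SET.
have [u hu] : {u : 'I_n -> 'rV[R]_d & forall i,
    F (u i) /\ (i \notin J -> 0 < dotr (u i) (c i))}.
  apply: (@choice _ _ (fun i ui => F ui /\ (i \notin J -> 0 < dotr ui (c i)))) => i.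
  have [iJ|niJ] := boolP (i \in J).
    by exists 0; split=> //; rewrite FE; split=> j *; rewrite dotr0l.
  have : exists u, F u /\ dotr u (c i) <> 0.
    apply: contrapT => h; move: niJ; rewrite inE => /asboolPn; apply=> v Fv.
    by apply: contrapT => ne; apply: h; exists v.
  move=> [v [Fv ne]]; exists v; split=> // _.
  by rewrite lt_neqAle eq_sym; apply/andP; split; [apply/eqP | apply: FC].
pose p := \sum_i u i.
have Fp : F p.
  rewrite FE; split=> [i|i iK]; rewrite dotr_suml.
    by apply: sumr_le0 => j _; have [] := hu j; rewrite FE => -[h _].
  by rewrite big1 // => j _; have [] := hu j; rewrite FE => -[_ h]; rewrite h.
have rp : rel_interior J p.
  move=> i; case: ifP => iJ; first by move: iJ; rewrite inE => /asboolP; apply.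
  rewrite dotr_suml (bigD1 i) //= ltr_pwDl //; first by apply (hu i).2; rewrite iJ.
  by apply: sumr_ge0 => j _; apply: FC; apply (hu j).1.
exists J; split; first by exists p.
apply/seteqP; split=> v.
  by move=> Fv; split=> [|i]; [apply: FC | rewrite inE => /asboolP; apply].
move=> [Cv Jv]; rewrite FE.
have va i : dotr v (a i) <= 0 by move: Cv; rewrite CE; apply.
split=> // i iK; apply/eqP; rewrite eq_le va /=.
have [|M [_ [+ _]]] := rel_interior_absorb (v := v) rp; first exact/mem_facet_space.
rewrite CE => /(_ i); rewrite dotrDl dotrNl dotrZl.
have -> : dotr p (a i) = 0 by move: Fp; rewrite FE => -[_ ->].
by rewrite mulr0 add0r oppr_le0.
Qed.

(** Every v with c_J(v) = 0 is the difference of M p + v and M p, both in the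
face when M is large. *)
Lemma linear_hull_pface J p : rel_interior J p ->
  is_linear_hull (pface J) (facet_space J).
Proof.
move=> rp; split=> [v [_ h]|W hW]; first exact/mem_facet_space.
apply/subvP => v /(rel_interior_absorb rp)[M [h _]].
rewrite -[v](addKr (M *: p)) addrC memvB ?memvZ //; first exact: (hW _ h).
by apply: (hW p); apply: rel_interior_pface.
Qed.

Lemma pface_inj J J' p p' : rel_interior J p -> rel_interior J' p' ->
  pface J = pface J' -> J = J'.
Proof.
move=> rp rp' e; have [_ hp] : pface J' p by rewrite -e; apply: rel_interior_pface.
have [_ hp'] : pface J p' by rewrite e; apply: rel_interior_pface.
apply/setP => i; apply/idP/idP => h.
  by have := rp' i; case: ifP => // _; rewrite hp' // ltxx.
by have := rp i; case: ifP => // _; rewrite hp // ltxx.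
Qed.

Lemma nfaces_pcone k : (forall i, c i != 0) ->
  nfaces k pcone =
  #|[pred J | `[< exists p, rel_interior J p >] & \dim (facet_space J) == k]|.
Proof.
move=> c0; apply: (card_fset_image (f := pface)) => [J J'|].
  move=> /andP[/asboolP[p rp] _] /andP[/asboolP[p' rp'] _].
  exact: pface_inj rp rp'.
apply/seteqP; split=> F /=.
  move=> [/is_face_pface[J [[p rp] ->]] [U [hU1 hU2] dU]]; exists J => //=.
  apply/andP; split; first by apply/asboolP; exists p.
  have [h1 h2] := linear_hull_pface rp; rewrite -dU; apply/eqP; congr (\dim _).
  by apply/eqP; rewrite eqEsubv h2 //= hU2.
move=> [J /andP[/asboolP[p rp] /eqP dJ] <-]; split; first exact: pface_is_face.
by exists (facet_space J) => //; apply: linear_hull_pface rp.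
Qed.

End Cones.

(** * Components and closures of open polyhedral cones *)
Section Topology.
Variables (R : realType) (d : nat).
Implicit Types (u v x : 'rV[R]_d) (A : set 'rV[R]_d).

Lemma dotr_continuous x : continuous (fun v => dotr v x).
Proof.
move=> v; rewrite /dotr.
have add_cont : continuous (fun z : R * R => z.1 + z.2) by exact: add_continuous.
apply: (@cvg_big _ _ +%R 0 xpredT add_cont _ (nbhs v) (index_enum 'I_d)
  (fun j (u : 'rV[R]_d) => u 0 j * x 0 j) (fun j => v 0 j * x 0 j)
  (nbhs_filter v)) => j _.
exact: (cvgM (@coord_continuous _ _ _ _ _ v) (cvg_cst _)).
Qed.

Lemma segment_continuous u v : continuous (fun t : R => u + t *: v).
Proof.
by move=> t; apply: cvgD; [exact: cvg_cst | exact: scalel_continuous].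
Qed.

(** The intermediate value theorem for the linear form x on A. *)
Lemma connected_pos A x u v : connected A ->
  (forall w, A w -> dotr w x != 0) -> A u -> A v ->
  0 < dotr u x -> 0 < dotr v x.
Proof.
move=> cA nz Au Av u0; rewrite ltNge; apply/negP => v0.
have /connected_intervalP itv : connected [set dotr w x | w in A].
  apply: connected_continuous_connected => //.
  exact/continuous_subspaceT/dotr_continuous.
have [|||w Aw w0] := itv (dotr v x) (dotr u x) _ _ 0.
- by exists v.
- by exists u.
- by rewrite v0 ltW.
- by have := nz w Aw; rewrite w0 eqxx.
Qed.

Lemma segment_component A u v :
  (forall t, 0 <= t <= 1 -> A (u + t *: (v - u))) -> connected_component A u v.
Proof.
move=> h; pose B := [set u + t *: (v - u) | t in `[0 : R, 1]%classic].
have Bu : B u by exists 0; rewrite ?scale0r ?addr0 //= in_itv /= lexx ler01.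
apply: (connected_component_max Bu).
- by move=> _ [t /= t01 <-]; apply: h; rewrite in_itv in t01.
- apply: connected_continuous_connected; first exact: segment_connected.
  exact/continuous_subspaceT/segment_continuous.
- by exists 1; rewrite /= ?in_itv /= ?ler01 ?lexx // scale1r addrC subrK.
Qed.

(** Any point of the closed cone is the limit, as t tends to 0, of its
translates by t v0, which lie in the open cone. *)
Lemma closure_pcone n (c : 'I_n -> 'rV[R]_d) v0 :
  (forall i, 0 < dotr v0 (c i)) ->
  closure [set v | forall i, 0 < dotr v (c i)] = pcone c.
Proof.
move=> h0; apply/seteqP; split=> v.
  move=> clv i; have : closed [set u | 0 <= dotr u (c i)].
    by apply: (preimage_closed _ (@closed_ge R 0)) => w _; exact: dotr_continuous.
  by apply; apply: closureS clv => w /= /(_ i)/ltW.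
move=> hv B nB.
have := @segment_continuous v v0 0; rewrite /continuous_at scale0r addr0.
move=> /(_ B nB) /nbhs_ballP[e /= e0 he].
exists (v + (e / 2) *: v0); split; last first.
  by apply: he; rewrite /ball /= sub0r normrN gtr0_norm ?divr_gt0 //; lra.
move=> i; rewrite dotrDl dotrZl; apply: ltr_wpDl; first exact: (hv i).
by rewrite mulr_gt0 ?divr_gt0.
Qed.

End Topology.

(** * The signed order of a point off the arrangement *)
Section SignedOrders.
Variables (R : realType) (d : nat) (I : finType) (y : I -> 'rV[R]_d).
Implicit Types (v : 'rV[R]_d) (l : wletter I) (w : seq (wletter I)) (s : seq I).
Local Notation ev v l := (dotr v (lval y l)).

Lemma sat_sorted v w : marks w = 0%N -> sat y <%R v w ->
  sorted (fun l l' => ev v l' < ev v l) w /\ (forall l, l \in w -> 0 < ev v l).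
Proof.
elim: w => [|l w IH] //=; case: l.2 => //= mw /andP[hl /(IH mw)[sw pw]].
have l0 : 0 < ev v l.
  case: w hl {IH mw sw} pw => [|l' w] /=; first by rewrite dotr0r.
  by move=> hl /(_ l' (mem_head _ _)) h; apply: lt_trans h hl.
split; first by case: w hl sw {IH mw pw} => //= l' w -> ->.
by move=> z; rewrite inE => /predU1P[->|/pw].
Qed.

Lemma sat_val_inj v w : marks w = 0%N -> sat y <%R v w ->
  {in w &, injective (fun l => ev v l)}.
Proof.
move=> mw /(sat_sorted mw)[sw _] l l' lw lw' e.
have : uniq (map (fun l => ev v l) w).
  apply: (sorted_uniq (leT := fun a b : R => b < a)).
  - by move=> a b c ba ac; apply: lt_trans ac ba.
  - exact: ltxx.
  - by rewrite sorted_map.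
move=> u; rewrite -(nth_index l lw) -(nth_index l lw'); congr nth; apply/eqP.
rewrite -(nth_uniq 0 _ _ u) ?size_map ?index_mem //.
by rewrite !(nth_map l) ?index_mem // !nth_index // e.
Qed.

(** Letters have positive values on a chamber, so the sign of a letter is the
sign of its linear form. *)
Lemma sat_lval v w l : marks w = 0%N -> sat y <%R v w -> l \in w ->
  ev v l = `|dotr v (y (label l))|.
Proof.
move=> mw /(sat_sorted mw)[_ pw] /pw h.
by rewrite -(gtr0_norm h) dotrZr normrM normr_sign mul1r.
Qed.

Lemma unmarked_mem w l : marks w = 0%N -> l \in w -> l.2 = false.
Proof.
move=> /eqP; rewrite -leqn0 leqNgt -has_count => /hasPn h /h.
by move=> /negbTE.
Qed.

(** By [sat_lval] the point determines the letters, and it sorts them. *)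
Lemma sat_unique v w w' : perm_eq (labels w) (labels w') ->
  marks w = 0%N -> marks w' = 0%N ->
  sat y <%R v w -> sat y <%R v w' -> w = w'.
Proof.
have sub u u' : perm_eq (labels u) (labels u') -> marks u = 0%N ->
    marks u' = 0%N -> sat y <%R v u -> sat y <%R v u' -> {subset u <= u'}.
  move=> uu' mu mu' su su' l lu.
  have : label l \in labels u' by rewrite -(perm_mem uu') map_f.
  move=> /mapP[l' lu' ll']; suff -> : l = l' by [].
  have [_ /(_ _ lu) h] := sat_sorted mu su; have [_ /(_ _ lu') h'] := sat_sorted mu' su'.
  have := unmarked_mem mu lu; have := unmarked_mem mu' lu'.
  case: l l' ll' h h' {lu lu'} => [[a t] m] [[a' t'] m'].
  rewrite /lval /label /= => <- + + -> ->; rewrite !dotrZr.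
  case: t t' => -[] //; rewrite expr1 expr0 mul1r mulN1r oppr_gt0 => h h';
    by have := lt_trans h h'; rewrite ltxx.
move=> ww' mw mw' sw sw'.
apply: (@irr_sorted_eq _ (fun l l' => ev v l' < ev v l)).
- by move=> a b c ba ac; apply: lt_trans ac ba.
- by move=> a; apply: ltxx.
- by have [] := sat_sorted mw sw.
- by have [] := sat_sorted mw' sw'.
- by move=> l; apply/idP/idP; apply: sub => //; rewrite perm_sym.
Qed.

Lemma sat_insert v w l : marks w = 0%N -> ~~ l.2 -> sat y <%R v w ->
  0 < ev v l -> (forall z, z \in w -> ev v l != ev v z) ->
  exists p, sat y <%R v (ins p l w).
Proof.
move=> + /negbTE l2; elim: w => [|z w IH] mw sw l0 ne.
  by exists 0%N; rewrite /= l2 dotr0r l0.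
move: mw sw => /=; case z2 : z.2 => //= mw /andP[hz sw].
have [lt|gt|e] := ltgtP (ev v z) (ev v l).
- by exists 0%N; rewrite /ins /= l2 z2 lt hz.
- have [|p hp] := IH mw sw l0; first by move=> z' h; apply: ne; rewrite inE h orbT.
  exists p.+1; rewrite /ins /= z2 hp andbT.
  by case: (w) p hz {hp} => [|z' w'] [|p].
- by have := ne z (mem_head _ _); rewrite e eqxx.
Qed.

(** Insertion sort of the letters +-y_a, the sign of each being chosen so that
its value at v is positive. *)
Lemma sat_exists v s : uniq s -> (forall a, a \in s -> dotr v (y a) != 0) ->
  (forall a b (sg : bool), a \in s -> b \in s -> a != b ->
     dotr v (y a) != (-1) ^+ sg * dotr v (y b)) ->
  exists w, [/\ perm_eq (labels w) s, marks w = 0%N & sat y <%R v w].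
Proof.
elim: s => [|a s IH] us h0 hne; first by exists [::].
case/andP: us => nas us; have [||w [lw mw sw]] := IH us.
- by move=> b bs; apply: h0; rewrite inE bs orbT.
- by move=> b c sg bs cs; apply: hne; rewrite inE ?bs ?cs orbT.
pose l : wletter I := (a, dotr v (y a) < 0, false).
have l0 : 0 < ev v l.
  have := h0 a (mem_head _ _); rewrite /l /lval dotrZr /= /label /=.
  have [lt|gt|//] := ltgtP (dotr v (y a)) 0 => _.
    by rewrite expr1 mulN1r oppr_gt0.
  by rewrite expr0 mul1r.
have [|p hp] := @sat_insert v w l mw isT sw l0.
  move=> z zw; rewrite /lval !dotrZr /=.
  have zs : label z \in s by rewrite -(perm_mem lw) map_f.
  have := hne a (label z) ((dotr v (y a) < 0) (+) z.1.2) (mem_head _ _).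
  rewrite inE zs orbT => /(_ isT).
  have az : a != label z by apply: contraNneq nas => ->.
  move=> /(_ az); apply: contra => /eqP e.
  rewrite signr_addb -mulrA -e mulrA -signr_addb addbb expr0 mul1r eqxx //.
exists (ins p l w); split=> //; last by rewrite marks_ins mw.
by rewrite (permPl (labels_ins _ _ _)) perm_cons.
Qed.

End SignedOrders.

(** * The cones of the Weyl tessellation and their faces *)
Section Weyl.
Variables (R : realType) (d n : nat) (y : 'I_n -> 'rV[R]_d).
Implicit Types (e : {ffun 'I_n -> bool}) (s : {perm 'I_n}) (J : {set 'I_n}).
Implicit Types (u v : 'rV[R]_d).
Local Notation c := (chain_vec y).
Local Notation noJ := (finset.set0 : {set 'I_n}).

Definition chamber e s : set 'rV[R]_d := [set v | forall i, 0 < dotr v (c e s i)].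

Lemma chamber_sat v e s : chamber e s v <-> sat y <%R v (word e s noJ).
Proof.
rewrite sat_word_lt; split=> h i; have := h i; first by rewrite finset.in_set0.
by rewrite finset.in_set0.
Qed.

Lemma marks_word0 e s : marks (word e s noJ) = 0%N.
Proof. by rewrite marks_word cards0. Qed.

Lemma realized_chamber e s : realized y e s noJ <-> exists v, chamber e s v.
Proof.
rewrite realizedP; split=> -[v h]; exists v => i; have := h i.
  by rewrite finset.in_set0.
by rewrite finset.in_set0.
Qed.

(** The same condition without the restriction i < j, and with the signs of the
two kinds of hyperplanes as a parameter. *)
Lemma not_arrangementB v : ~ arrangementB y v <->
  (forall a, dotr v (y a) != 0) /\
  (forall a b (sg : bool), a != b -> dotr v (y a) != (-1) ^+ sg * dotr v (y b)).
Proof.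
split=> [na|[h0 h]].
  have h (i j : 'I_n) : (i < j)%N -> forall sg : bool,
      dotr v (y i) != (-1) ^+ sg * dotr v (y j).
    move=> ij sg; apply/eqP => eq; apply: na; left; exists i, j; split=> //.
    case: sg eq; rewrite ?expr1 ?expr0 ?mulN1r ?mul1r => eq; [left|right];
      by rewrite /hyperplane /= ?dotrBr ?dotrDr eq ?addNr ?subrr.
  split=> [a|a b sg ab]; first by apply/eqP => a0; apply: na; right; exists a.
  have [lt|lt|eq] := ltngtP a b; first exact: (h a b lt sg).
    apply: contra (h b a lt sg) => /eqP->.
    by rewrite mulrA -signr_addb addbb expr0 mul1r.
  by case/eqP: ab; apply: val_inj.
move=> [[i [j [ij]]]|[i]]; last by apply/eqP.
have ne : i != j by rewrite neq_ltn ij.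
rewrite /hyperplane /= dotrBr dotrDr => -[/eqP|/eqP].
  by rewrite addr_eq0; have := h i j true ne; rewrite expr1 mulN1r => /negbTE ->.
by rewrite subr_eq0; have := h i j false ne; rewrite expr0 mul1r => /negbTE ->.
Qed.

Lemma chamber_exists v : ~ arrangementB y v -> exists e s, chamber e s v.
Proof.
move=> /not_arrangementB[h0 h].
have [||w [lw mw sw]] := @sat_exists _ _ _ y v (enum 'I_n) (enum_uniq _).
- by move=> a _; apply: h0.
- by move=> a b sg _ _; apply: h.
have zw : size w == n by rewrite -(size_map (@label 'I_n)) (perm_size lw) size_enum_ord.
have [e [s [J wE]]] := word_surj (w := Tuple zw) lw.
exists e, s; apply/chamber_sat; move: wE => /(congr1 val) /= wE.
move: mw sw; rewrite wE -[map _ _]/(tval (word e s J)) marks_word.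
by move=> /eqP; rewrite cards_eq0 => /eqP ->.
Qed.

Lemma chamber_not_arrangementB v e s : chamber e s v -> ~ arrangementB y v.
Proof.
move=> /chamber_sat sw; have mw := marks_word0 e s.
have letter a : exists2 l, l \in (word e s noJ : seq _) & label l = a.
  have : a \in labels (word e s noJ) by rewrite (perm_mem (labels_word _ _ _)) mem_enum.
  by move=> /mapP[l lw ->]; exists l.
apply/not_arrangementB; split=> [a|a b sg ab].
  have [l lw <-] := letter a; rewrite -normr_eq0 -(sat_lval mw sw lw).
  by have [_ /(_ l lw)] := sat_sorted mw sw; rewrite lt0r => /andP[].
have [l lw la] := letter a; have [l' lw' lb] := letter b.
apply: contra_neq ab => eq; rewrite -la -lb; congr label.
apply: (sat_val_inj mw sw) => //=.
by rewrite (sat_lval mw sw lw) (sat_lval mw sw lw') la lb eq normrM normr_sign mul1r.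
Qed.

Lemma chamber_unique v e s e' s' : chamber e s v -> chamber e' s' v ->
  e = e' /\ s = s'.
Proof.
move=> /chamber_sat sw /chamber_sat sw'.
have : word e s noJ = word e' s' noJ.
  apply: val_inj; apply: sat_unique sw sw'; rewrite ?marks_word0 //.
  by rewrite (perm_trans (labels_word _ _ _)) // perm_sym labels_word.
by move=> /word_inj[-> ->].
Qed.

Lemma chain_vec_neq0 v e s i : ~ arrangementB y v -> dotr v (c e s i) != 0.
Proof.
move=> /not_arrangementB[h0 h]; rewrite /chain_vec dotrBr subr_eq0 dotrZr.
case: insubP => [j _ ji|_] /=; last first.
  by rewrite dotr0r mulf_eq0 signr_eq0 h0.
have ne : s i != s j.
  by rewrite (inj_eq perm_inj); apply/eqP => ij; move: ji; rewrite /= ij => /n_Sn.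
rewrite dotrZr; apply: contra (h _ _ (e i (+) e j) ne) => /eqP eq.
by rewrite signr_addb -mulrA -eq mulrA -signr_addb addbb expr0 mul1r.
Qed.

(** The facet forms of a chamber do not vanish off the arrangement, so they keep
their signs on a connected set; conversely a chamber is convex. *)
Lemma component_chamber v e s : chamber e s v ->
  connected_component (~` arrangementB y) v = chamber e s.
Proof.
move=> cv; apply/seteqP; split=> u.
  move=> [A [Av Aarr cA]] Au i; apply: connected_pos cA _ Av Au (cv i).
  by move=> w /Aarr; apply: chain_vec_neq0.
move=> cu; apply: segment_component => t /andP[t0 t1].
apply: (@chamber_not_arrangementB _ e s) => i; have := cv i; have := cu i.
rewrite dotrDl dotrZl dotrDl dotrNl.
have [->|tn0] := eqVneq t 0; first by rewrite mul0r addr0.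
have {tn0 t0} t0 : 0 < t by rewrite lt0r tn0.
by nra.
Qed.

Lemma weylBE : weylB y =
  [set pcone (c es.1 es.2) | es in
    [set es : {ffun 'I_n -> bool} * {perm 'I_n} | realized y es.1 es.2 noJ]].
Proof.
apply/seteqP; split=> C.
  move=> [v va <-]; have [e [s cv]] := chamber_exists va.
  exists (e, s); first by apply/realized_chamber; exists v.
  by rewrite (component_chamber cv) (closure_pcone cv).
move=> [[e s] /realized_chamber[v cv] <-]; exists v.
  exact: chamber_not_arrangementB cv.
by rewrite (component_chamber cv) (closure_pcone cv).
Qed.

(** An interior point of one cone that lies in another closed cone is in the
interior of that one as well, as it is off the arrangement. *)
Lemma pcone_inj : {in [pred es : {ffun 'I_n -> bool} * {perm 'I_n} |
    realized y es.1 es.2 noJ] &,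
  injective (fun es => pcone (c es.1 es.2))}.
Proof.
move=> [e s] [e' s'] /realized_chamber /= [v cv] _ eq.
have na := chamber_not_arrangementB cv.
have : pcone (c e' s') v by rewrite -eq => i; apply: ltW.
move=> h; suff /(chamber_unique cv)[-> ->] : chamber e' s' v by [].
by move=> i; rewrite lt_neqAle eq_sym chain_vec_neq0 //=; apply: h.
Qed.

Hypothesis gpy : typeB_general_position y.

Lemma dim_facet_space e s J : \dim (facet_space (c e s) J) = (d - #|J|)%N.
Proof.
have := gen_pos_typeB gpy (labels_word e s J); rewrite marks_word dim_rV capfv => <-.
congr (\dim _); apply/vspaceP => v.
by apply/mem_facet_space/mem_kerw_word.
Qed.

Lemma chain_vec_nonzero e s i : (0 < d)%N -> c e s i != 0.
Proof.
move=> d0; apply/eqP => ci; have := dim_facet_space e s [set i]%SET.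
have -> : facet_space (c e s) [set i]%SET = fullv.
  apply/vspaceP => v; rewrite memvf; apply/mem_facet_space => j.
  by rewrite finset.in_set1 => /eqP ->; rewrite ci dotr0r.
by rewrite dim_rV cards1; lia.
Qed.

(** If a chain has a face in general position, then its chamber is not empty:
the equalities can be relaxed one by one, since dropping one of them raises
the dimension of the space of solutions, which allows a move that makes it a
strict inequality. *)
Lemma realized_sub e s J : (#|J| <= d)%N -> realized y e s J -> realized y e s noJ.
Proof.
have [m] := ubnP #|J|; elim: m J => // m IH J Jm Jd rJ.
have [J0|[j jJ]] := set_0Vmem J; first by rewrite -J0.
have cJ : #|J| = #|J :\ j|.+1 by rewrite (cardsD1 j) jJ.
apply: (IH (J :\ j)); rewrite -?cJ //; first by rewrite (leq_trans _ Jd) // cJ.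
have [u uJ uj] : exists2 u, u \in facet_space (c e s) (J :\ j) & 0 < dotr u (c e s j).
  have [u uJ uj] : exists2 u, u \in facet_space (c e s) (J :\ j) &
      u \notin hyperv (c e s j).
    apply: contrapT => nex.
    have : (facet_space (c e s) (J :\ j) <= facet_space (c e s) J)%VS.
      apply/subvP => v vJ; apply/mem_facet_space => i iJ.
      have [->|ne] := eqVneq i j; last first.
        by move: vJ => /mem_facet_space; apply; rewrite !inE ne.
      apply: contrapT => /eqP h; apply: nex; exists v => //; rewrite mem_hyperv //.
    by move=> /dimvS; rewrite !dim_facet_space; lia.
  move: uj; rewrite mem_hyperv; have [lt|lt|//] := ltgtP (dotr u (c e s j)) 0 => _.
    by exists (- u); rewrite ?memvN // dotrNl oppr_gt0.
  by exists u.
move: rJ => /realizedP[p rp]; apply/realizedP.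
(* The summand 1 turns the weak inequalities at M p + u into strict ones. *)
pose M := 1 + \sum_i `|dotr u (c e s i)| / dotr p (c e s i).
have p0 i : 0 <= dotr p (c e s i) by have := rp i; case: ifP => _ => [->|/ltW].
have zp i : i \in J -> dotr p (c e s i) = 0 by have := rp i; case: ifP.
exists (M *: p + u) => i; rewrite dotrDl dotrZl !inE.
have [->|ne] := eqVneq i j; first by rewrite /= zp // mulr0 add0r.
case: ifP => /= iJ.
  rewrite zp // mulr0 add0r; move: uJ => /mem_facet_space; apply.
  by rewrite !inE ne.
have := rp i; rewrite iJ => pi.
have : `|dotr u (c e s i)| <= (M - 1) * dotr p (c e s i).
  rewrite -ler_pdivrMr // /M addrC addKr (bigD1 i) //= lerDl.
  by apply: sumr_ge0 => l _; rewrite divr_ge0.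
by have := ler_norm (- dotr u (c e s i)); rewrite normrN; nra.
Qed.

Lemma nmeets_realized r : nmeets y n (enum 'I_n) fullv r =
  (\sum_(es : {ffun 'I_n -> bool} * {perm 'I_n}) \sum_(J : {set 'I_n} | #|J| == r)
     realized y es.1 es.2 J)%N.
Proof. by rewrite nmeets_word pair_big_dep. Qed.

Lemma card_weylB : #|` fset_set (weylB y)| = nchambers n d.
Proof.
rewrite (card_fset_image pcone_inj weylBE) -sum1_card big_mkcond /=.
transitivity (nmeets y n (enum 'I_n) fullv 0); last first.
  by rewrite (nmeets0 _ _ (gen_pos_typeB gpy)) ?enum_uniq ?size_enum_ord ?dim_rV.
rewrite nmeets_realized; apply: eq_bigr => es _.
rewrite (big_pred1 noJ) => [|J]; last by rewrite cards_eq0.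
by rewrite inE; case: realized.
Qed.

(** Summing over cones and faces is summing over all marked words, as a chain
with a face that is met belongs to a cone by [realized_sub]. *)
Lemma sum_nfaces_weylB k : (0 < k)%N -> (k <= d)%N ->
  \sum_(C \in weylB y) ((nfaces k C)%:R : R) =
  (nmeets y n (enum 'I_n) fullv (d - k)%N)%:R.
Proof.
move=> k0 kd; rewrite (fsum_image pcone_inj weylBE) nmeets_realized natr_sum.
rewrite big_mkcond; apply: eq_bigr => -[e s] _; rewrite inE /=.
have Jk J : (\dim (facet_space (c e s) J) == k) = (#|J| == (d - k)%N).
  by rewrite dim_facet_space; lia.
case: ifPn => [rs|nrs].
  rewrite nfaces_pcone => [|i]; last by rewrite chain_vec_nonzero // (leq_trans k0).
  rewrite -sum1_card [in RHS]big_mkcond [in LHS]big_mkcond; congr _%:R.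
  apply: eq_bigr => J _; rewrite inE Jk andbC; case: eqP => //= _.
  rewrite (_ : `[< _ >] = realized y e s J); first by case: realized.
  by apply/asboolP/idP => /realizedP.
rewrite big1 // => J /eqP JE; apply/eqP; rewrite eqb0; apply: contra nrs.
by apply: realized_sub; rewrite JE leq_subr.
Qed.

Lemma weylB_mean_nfaces k : (0 < k)%N -> (k <= d)%N ->
  weylB_mean y (fun C => (nfaces k C)%:R) =
  (2 ^+ (d - k) * 'C(n, d - k)%:R * (DB (n - d + k) k)%:~R / (DB n d)%:~R)
   * (n`!%:R / (n - d + k)`!%:R).
Proof.
move=> k0 kd; have dn : (d <= n)%N by case: gpy.
rewrite /weylB_mean card_weylB sum_nfaces_weylB // !DB_nchambers; [|lia|lia].
have := @nmeets_count _ _ _ y (d - k) n (enum 'I_n) fullv.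
rewrite enum_uniq size_enum_ord dim_rV (leq_trans (leq_subr _ _) dn).
move=> /(_ isT isT erefl (gen_pos_typeB gpy)).
rewrite subKn // (_ : (n - (d - k) = n - d + k)%N); last by lia.
move=> /(congr1 (fun m : nat => m%:R : R)); rewrite !natrM natrX => key.
have f0 : ((n - d + k)`!%:R : R) != 0 by rewrite pnatr_eq0 -lt0n fact_gt0.
rewrite -[X in _ * X = _](mulfK f0) key -!pmulrn.
by rewrite [RHS]mulrA; ring.
Qed.

End Weyl.

(** * Expectation of an almost surely constant variable *)
Section AlmostSurelyConstant.
Local Open Scope ereal_scope.
Variables (R : realType) (disp : measure_display) (T : measurableType disp).

(** The integral of a nonnegative function is a supremum over the simple
functions below it. *)
Lemma ge0_integral_mono (mu : {measure set T -> \bar R})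
    (f g : T -> \bar R) : (forall x, 0 <= f x) -> (forall x, f x <= g x) ->
  \int[mu]_x f x <= \int[mu]_x g x.
Proof.
move=> f0 fg; have g0 x : 0 <= g x by apply: le_trans (fg x).
rewrite !ge0_integralTE //; apply: le_ereal_sup => _ [h /= hf <-].
by exists h => //= x; apply: le_trans (fg x).
Qed.

(** Only the values of X off a null set N are known, so X is squeezed between
the measurable functions equal to r off N and to 0, respectively infinity, on N. *)
Lemma expectation_ae_cst (P : probability T R) (X : T -> R) (r : R) :
  (forall w, 0 <= X w)%R -> {ae P, forall w, X w = r} -> 'E_P[X] = r%:E.
Proof.
move=> X0 [N [mN PN sub]]; rewrite unlock.
have XN w : ~ N w -> X w = r by move=> nN; apply: contrapT => h; apply/nN/sub.
have mNC : measurable (~` N) by apply: measurableC.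
have PNC : P (~` N) = 1 by rewrite probability_setC // PN sube0.
have r0 : (0 <= r)%R.
  have [w nw] : exists w, ~ N w.
    apply: contrapT => h; suff NT : N = setT.
      by move: PN; rewrite NT probability_setT => /eqP; rewrite onee_eq0.
    by apply/seteqP; split=> // w _; apply: contrapT => nw; apply: h; exists w.
  by rewrite -(XN w nw).
pose lo : T -> \bar R := cst r%:E \_ (~` N).
pose up : T -> \bar R := cst +oo \_ N.
have lo0 w : 0 <= lo w by rewrite /lo patchE; case: ifP; rewrite ?lee_fin.
have up0 w : 0 <= up w by rewrite /up patchE; case: ifP => _; rewrite /= ?leey.
have ilo : \int[P]_w lo w = r%:E.
  by rewrite -integral_mkcond integral_cst // -[RHS]mule1; congr (_ * _); exact: PNC.
have iup : \int[P]_w up w = 0.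
  by rewrite -integral_mkcond integral_cst // -[RHS](mule0 +oo); congr (_ * _); exact: PN.
have mlo : measurable_fun [set: T] lo.
  by apply: (measurable_restrictT _ mNC).1; exact: measurable_cst.
have mup : measurable_fun [set: T] up.
  by apply: (measurable_restrictT _ mN).1; exact: measurable_cst.
apply/eqP; rewrite eq_le; apply/andP; split.
  rewrite -[leRHS]add0e -{1}iup -ilo -ge0_integralD //.
  - apply: ge0_integral_mono => w; first by rewrite lee_fin.
    rewrite /lo /up !patchE in_setC; case: (boolP (w \in N)) => [_|/negP nN] /=.
      by rewrite adde0 leey.
    by rewrite add0e XN // => h; apply: nN; rewrite inE.
rewrite -ilo; apply: ge0_integral_mono => // w.
rewrite /lo patchE in_setC; case: (boolP (w \in N)) => [_|/negP nN] /=.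
  by rewrite lee_fin.
by rewrite XN // => h; apply: nN; rewrite inE.
Qed.

End AlmostSurelyConstant.

Theorem theorem1p7 (R : realType) (disp : measure_display)
  (T : measurableType disp) (P : probability T R)
  (d n : nat) (hd : (2 <= d)%N)
  (Y : 'I_n -> T -> 'rV[R]_d)
  (hY : forall i : 'I_n, random_vector (Y i))
  (hgp : {ae P, forall w, typeB_general_position (fun i => Y i w)})
  (k : nat) (hk1 : (1 <= k)%N) (hkd : (k <= d)%N) :
  weylB_cone_expectation P Y (fun C => (nfaces k C)%:R) =
  ((2 ^+ (d - k) * 'C(n, d - k)%:R * (DB (n - d + k) k)%:~R / (DB n d)%:~R)
   * (n`!%:R / (n - d + k)`!%:R))%:E.
Proof.
apply: expectation_ae_cst.
  move=> w; rewrite mulr_ge0 ?invr_ge0 ?ler0n //.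
  by apply: fsumr_ge0 => C _; exact: ler0n.
by apply: filterS hgp => w gw; apply: weylB_mean_nfaces.
Qed.
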